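(* Let $S$ be a multiplicative subsemigroup of $\mathbb{N}$. Then $$(\mathscr{H}^\infty_S)^{-1}=\left\{f\in\mathscr{H}^\infty_S:\ \inf_{s\in\mathbb{C}_0}|f(s)|>0\right\}.$$
   Context: $\mathbb{N}=\{1,2,3,\dots\}$ and $\mathbb{C}_0=\{s\in\mathbb{C}:\operatorname{Re}(s)>0\}$. $\mathscr{H}^\infty$ is the set of all Dirichlet series $f=\sum_{n=1}^\infty a_n n^{-s}$ ($a_n\in\mathbb{C}$ for all $n\in\mathbb{N}$) that converge at each $s\in\mathbb{C}_0$ and satisfy $\|f\|_\infty:=\sup_{s\in\mathbb{C}_0}|f(s)|<\infty$; it is a Banach algebra with pointwise operations and the norm $\|\cdot\|_\infty$. For $S\subset\mathbb{N}$, $\mathscr{H}^\infty_S$ is the set of all $f=\sum_{n=1}^\infty a_n n^{-s}\in\mathscr{H}^\infty$ such that $a_n=0$ for all $n\in\mathbb{N}\setminus S$. A subset $S$ of $\mathbb{N}$ is a multiplicative subsemigroup of $\mathbb{N}$ if $s_1s_2\in S$ for all $s_1,s_2\in S$. $(\mathscr{H}^\infty_S)^{-1}$ denotes the set of invertible elements of $\mathscr{H}^\infty_S$, i.e., of all $f\in\mathscr{H}^\infty_S$ for which there exists $g\in\mathscr{H}^\infty_S$ with $f(s)g(s)=1$ for all $s\in\mathbb{C}_0$. *)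

(* Defs.v *)
From Stdlib Require Export Reals.
From Coquelicot Require Export Coquelicot.
Open Scope R_scope.

(** The open right half-plane, as a type: functions [C0 -> C] carry no junk
    values outside the half-plane. *)
Definition C0 : Type := {s : C | 0 < Re s}.

Definition C0_val (s : C0) : C := proj1_sig s.
Coercion C0_val : C0 >-> C.

Definition Cexp (z : C) : C := (exp (Re z) * cos (Im z), exp (Re z) * sin (Im z)).

(** [n^{-s} = exp (-s log n)]; only used for [1 <= n]. *)
Definition npow_neg (n : nat) (s : C) : C :=
  Cexp (Copp s * RtoC (ln (INR n)))%C.

(** [f = sum_{n >= 1} a_n n^{-s}], convergent at every point of the half-plane.
    The series of Coquelicot starts at [0], hence the shift; [a 0] is unused. *)
Definition is_dirichlet_series (a : nat -> C) (f : C0 -> C) : Prop :=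
  forall s : C0,
    @is_series C_AbsRing C_NormedModule
      (fun k => (a (S k) * npow_neg (S k) s)%C) (f s).

Definition modulus_values (f : C0 -> C) : R -> Prop :=
  fun x => exists s : C0, x = Cmod (f s).

Definition sup_norm (f : C0 -> C) : Rbar := Lub_Rbar (modulus_values f).
Definition inf_modulus (f : C0 -> C) : Rbar := Glb_Rbar (modulus_values f).

Definition Hinf (f : C0 -> C) : Prop :=
  (exists a : nat -> C, is_dirichlet_series a f) /\ Rbar_lt (sup_norm f) p_infty.

(** The coefficients of a convergent Dirichlet series are determined by its sum,
    so quantifying existentially over them is harmless. *)
Definition HinfS (A : nat -> Prop) (f : C0 -> C) : Prop :=
  Hinf f /\
  exists a : nat -> C,
    is_dirichlet_series a f /\
    forall n : nat, (1 <= n)%nat -> ~ A n -> a n = RtoC 0.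

Definition HinfS_invertible (A : nat -> Prop) (f : C0 -> C) : Prop :=
  HinfS A f /\
  exists g : C0 -> C, HinfS A g /\ forall s : C0, (f s * g s)%C = RtoC 1.

(** Here the natural numbers start at [1], so [0] is excluded explicitly. *)
Definition mult_subsemigroup (A : nat -> Prop) : Prop :=
  (forall n : nat, A n -> (1 <= n)%nat) /\
  (forall m n : nat, A m -> A n -> A (m * n)%nat).

(* Main.v *)
(* The set [uniform_dirichlet A] of uniform limits, on the half-plane, of Dirichlet
   polynomials supported on [A] is an algebra, and three facts about it give the theorem.

   Translates [f(. + eps)] of [f] in [H^infty_A] belong to it: the Taylor expansion of [f] at
   [s + 4 + eps], where the series converges absolutely, reaches [s + eps]; Cauchy estimates
   for the partial sums bound its remainder uniformly in [s].

   If [F] belongs to it and [|F| >= delta], so does [1/F]: [F(. + t)] tends to a constant as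
   [t] grows, and Neumann series of a fixed step bring the inverse back to [t = 0].

   Its members are Dirichlet series convergent on the half-plane: a Dirichlet polynomial
   bounded by [M] has partial sums of length [n] bounded by [O(M log n)] (Bohr). Indeed
   multiplying the coefficients by a hat function of [log n] of height [a] costs at most a
   factor [a], hats being positive definite, and the indicator of an initial segment of the
   integers is a combination of [O(log n)] hats. *)

Require Import Defs.
From Stdlib Require Import Lra Lia ZArith Classical ClassicalEpsilon.

(** * Finite sums and roots of unity *)

(** A bounded Dirichlet series need not be uniformly continuous up to the imaginary axis, so in
    general it is no uniform limit of Dirichlet polynomials on the half-plane; hence the detour
    through translates. The inverse of the translate by [eps] yields coefficients which, moved back
    by [eps], are controlled only on [Re s > eps]; uniqueness of coefficients glues these series
    into a single one. The unit is a second obstacle: [1] is not assumed to lie in [A], yet Neumann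
    series need constants. A function bounded below does not tend to [0] far to the right, so its
    constant coefficient is nonzero, and this puts [1] into [A]. The analysis runs on finite sums.
    Averages over roots of unity replace Cauchy integrals, and hats are averages of finitely many
    characters with Fejér weights, so no integral occurs. *)

Fixpoint csum (u : nat -> C) (n : nat) : C :=
  match n with O => RtoC 0 | S m => (csum u m + u m)%C end.

Fixpoint rsum (u : nat -> R) (n : nat) : R :=
  match n with O => 0 | S m => rsum u m + u m end.

Lemma csum_ext (u v : nat -> C) n :
  (forall k, (k < n)%nat -> u k = v k) -> csum u n = csum v n.
Proof.
  induction n as [|n IH]; intros H; [reflexivity|]. simpl.
  rewrite IH by (intros; apply H; lia). rewrite H by lia. reflexivity.
Qed.

Lemma csum_add u v n : csum (fun k => u k + v k)%C n = (csum u n + csum v n)%C.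
Proof. induction n as [|n IH]; simpl; [ring|]. rewrite IH. ring. Qed.

Lemma csum_sub u v n : csum (fun k => u k - v k)%C n = (csum u n - csum v n)%C.
Proof. induction n as [|n IH]; simpl; [ring|]. rewrite IH. ring. Qed.

Lemma csum_scal c u n : csum (fun k => c * u k)%C n = (c * csum u n)%C.
Proof. induction n as [|n IH]; simpl; [ring|]. rewrite IH. ring. Qed.

Lemma csum_scal_r c u n : csum (fun k => u k * c)%C n = (csum u n * c)%C.
Proof. induction n as [|n IH]; simpl; [ring|]. rewrite IH. ring. Qed.

Lemma csum_zero n : csum (fun _ => RtoC 0) n = RtoC 0.
Proof. induction n as [|n IH]; simpl; [reflexivity|]. rewrite IH. ring. Qed.

Lemma csum_const c n : csum (fun _ => c) n = (RtoC (INR n) * c)%C.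
Proof.
  induction n as [|n IH]; [cbn; try ring|].
  cbn [csum]. rewrite IH, S_INR, RtoC_plus. ring.
Qed.

Lemma csum_swap (u : nat -> nat -> C) m n :
  csum (fun i => csum (u i) n) m = csum (fun j => csum (fun i => u i j) m) n.
Proof.
  induction m as [|m IH]; simpl; [now rewrite csum_zero|].
  rewrite IH, <- csum_add. reflexivity.
Qed.

Lemma csum_shift u n : csum u (S n) = (u O + csum (fun k => u (S k)) n)%C.
Proof.
  induction n as [|n IH]; [cbn [csum]; ring|].
  cbn [csum] in *. rewrite IH. ring.
Qed.

Lemma csum_split u m n :
  csum u (m + n) = (csum u m + csum (fun k => u (m + k)%nat) n)%C.
Proof.
  induction n as [|n IH]; [rewrite Nat.add_0_r; cbn [csum]; ring|].
  rewrite Nat.add_succ_r. cbn [csum]. rewrite IH. ring.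
Qed.

Lemma csum_tail_zero u m n :
  (m <= n)%nat -> (forall k, (m <= k)%nat -> u k = RtoC 0) -> csum u n = csum u m.
Proof.
  intros Hmn H. replace n with (m + (n - m))%nat by lia.
  rewrite csum_split, (csum_ext (fun k => u (m + k)%nat) (fun _ => RtoC 0)), csum_zero;
    [ring|].
  intros k _. apply H. lia.
Qed.

Lemma csum_single u n k :
  (k < n)%nat -> (forall i, (i < n)%nat -> i <> k -> u i = RtoC 0) -> csum u n = u k.
Proof.
  induction n as [|n IH]; intros Hk H; [lia|]. cbn [csum].
  destruct (Nat.eq_dec k n) as [->|Hn].
  - rewrite (csum_ext _ (fun _ => RtoC 0)), csum_zero; [ring|].
    intros i Hi. apply H; lia.
  - rewrite IH by (try lia; intros; apply H; lia). rewrite (H n) by lia. ring.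
Qed.

Lemma rsum_ext (u v : nat -> R) n :
  (forall k, (k < n)%nat -> u k = v k) -> rsum u n = rsum v n.
Proof.
  induction n as [|n IH]; intros H; [reflexivity|]. simpl.
  rewrite IH by (intros; apply H; lia). rewrite H by lia. reflexivity.
Qed.

Lemma rsum_add u v n : rsum (fun k => u k + v k) n = rsum u n + rsum v n.
Proof. induction n as [|n IH]; simpl; [ring|]. rewrite IH. ring. Qed.

Lemma rsum_scal c u n : rsum (fun k => c * u k) n = c * rsum u n.
Proof. induction n as [|n IH]; simpl; [ring|]. rewrite IH. ring. Qed.

Lemma rsum_scal_r c u n : rsum (fun k => u k * c) n = rsum u n * c.
Proof. induction n as [|n IH]; simpl; [ring|]. rewrite IH. ring. Qed.

Lemma rsum_nonneg u n : (forall k, (k < n)%nat -> 0 <= u k) -> 0 <= rsum u n.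
Proof.
  induction n as [|n IH]; intros H; simpl; [lra|].
  apply Rplus_le_le_0_compat; [apply IH; intros|]; apply H; lia.
Qed.

Lemma rsum_telescope v n : rsum (fun k => v k - v (S k)) n = v O - v n.
Proof. induction n as [|n IH]; simpl; [ring|]. rewrite IH. ring. Qed.

Lemma csum_RtoC u n : csum (fun k => RtoC (u k)) n = RtoC (rsum u n).
Proof.
  induction n as [|n IH]; simpl; [reflexivity|].
  rewrite IH, RtoC_plus. reflexivity.
Qed.

Lemma Cconj_csum u n : Cconj (csum u n) = csum (fun k => Cconj (u k)) n.
Proof.
  induction n as [|n IH]; cbn [csum].
  - unfold Cconj, RtoC; simpl. f_equal. ring.
  - rewrite Cplus_conj, IH. reflexivity.
Qed.

Lemma Cmod_csum_le u v n :
  (forall k, (k < n)%nat -> Cmod (u k) <= v k) -> Cmod (csum u n) <= rsum v n.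
Proof.
  induction n as [|n IH]; intros H; simpl; [rewrite Cmod_0; lra|].
  eapply Rle_trans; [apply Cmod_triangle|].
  apply Rplus_le_compat; [apply IH; intros|]; apply H; lia.
Qed.

Lemma Cmod_RtoC_nonneg x : 0 <= x -> Cmod (RtoC x) = x.
Proof. intros H. rewrite Cmod_R. now apply Rabs_pos_eq. Qed.

Lemma Cmod_sub_sym x y : Cmod (x - y)%C = Cmod (y - x)%C.
Proof. rewrite <- Cmod_opp. f_equal. ring. Qed.

Lemma Cmod_triangle_sub x y : Cmod x <= Cmod y + Cmod (x - y)%C.
Proof. replace x with (y + (x - y))%C at 1 by ring. apply Cmod_triangle. Qed.

Lemma Cmod_triangle3 x y z : Cmod (x - z)%C <= Cmod (x - y)%C + Cmod (y - z)%C.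
Proof. replace (x - z)%C with ((x - y) + (y - z))%C by ring. apply Cmod_triangle. Qed.

Lemma Cmod_le_Re_Im z : Cmod z <= Rabs (Re z) + Rabs (Im z).
Proof.
  replace z with (RtoC (Re z) + Ci * RtoC (Im z))%C at 1.
  - eapply Rle_trans; [apply Cmod_triangle|]. rewrite Cmod_mult, !Cmod_R.
    replace (Cmod Ci) with 1; [lra|].
    unfold Cmod, Ci; simpl. transitivity (sqrt 1); [symmetry; apply sqrt_1|f_equal; ring].
  - destruct z as [p q]. apply injective_projections; simpl; ring.
Qed.

Lemma Rabs_Re_Im_le z : Rabs (Re z) <= Cmod z /\ Rabs (Im z) <= Cmod z.
Proof.
  pose proof (Rmax_Cmod z) as Hz.
  pose proof (Rmax_l (Rabs (fst z)) (Rabs (snd z))).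
  pose proof (Rmax_r (Rabs (fst z)) (Rabs (snd z))). unfold Re, Im. lra.
Qed.

Lemma le_of_forall_eps x y c :
  0 <= c -> (forall e, 0 < e -> x <= y + c * e) -> x <= y.
Proof.
  intros Hc H. apply Rnot_lt_le. intros Hlt.
  assert (H0 := H ((x - y) / (2 * (c + 1)))).
  assert (Hp : 0 < (x - y) / (2 * (c + 1))) by (apply Rdiv_lt_0_compat; lra).
  specialize (H0 Hp).
  assert (c * ((x - y) / (2 * (c + 1))) <= (x - y) / 2).
  { replace ((x - y) / 2) with ((c + 1) * ((x - y) / (2 * (c + 1)))) by (field; lra).
    apply Rmult_le_compat_r; lra. }
  lra.
Qed.

Lemma Cmult_sub_distr_l x y z : (x * (y - z) = x * y - x * z)%C.
Proof. ring. Qed.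

Lemma exp_mono x y : x <= y -> exp x <= exp y.
Proof.
  intros [H| ->]; [apply Rlt_le, exp_increasing, H|apply Rle_refl].
Qed.

Lemma le_INR_exists x : exists n : nat, x <= INR n.
Proof. destruct (INR_unbounded x) as [n Hn]. exists n. lra. Qed.

Definition cis (x : R) : C := (cos x, sin x).

Lemma cis_add x y : cis (x + y) = (cis x * cis y)%C.
Proof. unfold cis, Cmult; simpl. rewrite cos_plus, sin_plus. f_equal; ring. Qed.

Lemma cis_0 : cis 0 = RtoC 1.
Proof. unfold cis. rewrite cos_0, sin_0. reflexivity. Qed.

Lemma cis_opp x : cis (- x) = Cconj (cis x).
Proof. unfold cis, Cconj; simpl. now rewrite cos_neg, sin_neg. Qed.

Lemma Cmod_cis x : Cmod (cis x) = 1.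
Proof.
  unfold Cmod, cis; simpl. transitivity (sqrt 1); [f_equal|apply sqrt_1].
  pose proof (sin2_cos2 x) as H. unfold Rsqr in H. rewrite !Rmult_1_r, Rplus_comm.
  exact H.
Qed.

Lemma Cmod_cis_sub_1 x : Cmod (cis x - 1)%C ^ 2 = 2 - 2 * cos x.
Proof.
  unfold Cmod. rewrite pow2_sqrt
    by (apply Rplus_le_le_0_compat; apply pow2_ge_0).
  unfold cis; simpl.
  pose proof (sin2_cos2 x) as H. unfold Rsqr in H. nra.
Qed.

Lemma cis_INR_mult x n : cis (INR n * x) = Cpow (cis x) n.
Proof.
  induction n as [|n IH]; [simpl; rewrite Rmult_0_l; apply cis_0|].
  rewrite S_INR, Rmult_plus_distr_r, Rmult_1_l, cis_add, IH, Cpow_S. ring.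
Qed.

Lemma cis_2PI_INR n : cis (2 * PI * INR n) = RtoC 1.
Proof.
  rewrite Rmult_comm, cis_INR_mult.
  replace (cis (2 * PI)) with (RtoC 1) by (unfold cis; now rewrite cos_2PI, sin_2PI).
  apply Cpow_1_l.
Qed.

Lemma cis_2PI_IZR z : cis (2 * PI * IZR z) = RtoC 1.
Proof.
  destruct (Z_le_gt_dec 0 z) as [H|H].
  - rewrite <- (Z2Nat.id z H), <- INR_IZR_INZ. apply cis_2PI_INR.
  - replace (2 * PI * IZR z) with (- (2 * PI * INR (Z.to_nat (- z)))).
    + rewrite cis_opp, cis_2PI_INR. unfold Cconj, RtoC; simpl. f_equal. ring.
    + rewrite INR_IZR_INZ, Z2Nat.id by lia. rewrite opp_IZR. ring.
Qed.

Lemma geometric_csum q n : ((q - 1) * csum (Cpow q) n = Cpow q n - 1)%C.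
Proof.
  induction n as [|n IH]; [cbn; try ring|].
  cbn [csum]. rewrite Cmult_plus_distr_l, IH, Cpow_S. ring.
Qed.

Lemma roots_of_unity_sum Q z :
  (0 < Z.abs z < Z.of_nat Q)%Z ->
  csum (fun j => cis (INR j * (2 * PI * IZR z / INR Q))) Q = RtoC 0.
Proof.
  intros Hz. set (x := 2 * PI * IZR z / INR Q).
  assert (HQ : 0 < INR Q) by (apply (lt_INR 0); lia).
  rewrite (csum_ext _ (Cpow (cis x))) by (intros; apply cis_INR_mult).
  (* If [cis x = 1] then [sin (x / 2) = 0], but [|x / 2| = PI |z| / Q] lies strictly between [0] and
     [PI]. *)
  assert (Hq : (cis x - 1)%C <> RtoC 0).
  { intros H0.
    assert (Hc : cos x = 1).
    { pose proof (Cmod_cis_sub_1 x) as H1. rewrite H0, Cmod_0 in H1. lra. }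
    pose proof (cos_2a_sin (x / 2)) as H1.
    replace (2 * (x / 2)) with x in H1 by field. rewrite Hc in H1.
    assert (Hs : sin (x / 2) = 0) by nra.
    assert (Habs : sin (Rabs (x / 2)) = 0).
    { unfold Rabs. destruct (Rcase_abs (x / 2)); [rewrite sin_neg|]; lra. }
    pose proof PI_RGT_0.
    assert (Hx : Rabs (x / 2) = PI * (IZR (Z.abs z) / INR Q)).
    { unfold x. replace (2 * PI * IZR z / INR Q / 2) with (PI / INR Q * IZR z) by (field; lra).
      rewrite Rabs_mult, Rabs_Zabs. rewrite (Rabs_pos_eq (PI / INR Q)); [field; lra|].
      apply Rlt_le, Rdiv_lt_0_compat; lra. }
    assert (0 < IZR (Z.abs z) / INR Q).
    { apply Rdiv_lt_0_compat; [apply IZR_lt; lia|lra]. }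
    assert (IZR (Z.abs z) / INR Q < 1).
    { apply (Rmult_lt_reg_r (INR Q)); [lra|].
      unfold Rdiv; rewrite Rmult_assoc, Rinv_l, Rmult_1_r, Rmult_1_l by lra.
      rewrite INR_IZR_INZ. apply IZR_lt; lia. }
    assert (0 < sin (Rabs (x / 2))) by (apply sin_gt_0; rewrite Hx; nra).
    lra. }
  pose proof (geometric_csum (cis x) Q) as H.
  rewrite <- cis_INR_mult in H.
  replace (INR Q * x) with (2 * PI * IZR z) in H by (unfold x; field; lra).
  rewrite cis_2PI_IZR in H.
  replace (csum (Cpow (cis x)) Q)
    with (/ (cis x - 1) * ((cis x - 1) * csum (Cpow (cis x)) Q))%C by (field; exact Hq).
  rewrite H. ring.
Qed.

(** * Hat functions as Fourier multipliers *)

Lemma count_eq (m : nat) (c : Z) :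
  rsum (fun k => if Z.eqb (Z.of_nat k) c then 1 else 0) m =
  if (Z.leb 0 c && Z.ltb c (Z.of_nat m))%bool then 1 else 0.
Proof.
  induction m as [|m IH]; cbn [rsum].
  - destruct (Z.leb_spec 0 c), (Z.ltb_spec c (Z.of_nat 0)); simpl; try reflexivity; lia.
  - rewrite IH.
    destruct (Z.leb_spec 0 c), (Z.ltb_spec c (Z.of_nat m)), (Z.eqb_spec (Z.of_nat m) c),
      (Z.ltb_spec c (Z.of_nat (S m))); simpl; try lra; lia.
Qed.

(** With [n = m] this is the autocorrelation at [z] of the indicator of [{0, ..., m - 1}], hence a
    discrete hat of height [m]; it evaluates the double sum in [tri_poly_int]. *)
Lemma count_window (m n : nat) (z : Z) :
  rsum (fun k => if (Z.leb 0 (Z.of_nat k + z) && Z.ltb (Z.of_nat k + z) (Z.of_nat m))%bool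
                 then 1 else 0) n =
  IZR (Z.max 0 (Z.min (Z.of_nat n) (Z.of_nat m - z) - Z.max 0 (- z))).
Proof.
  induction n as [|n IH]; cbn [rsum].
  - f_equal. lia.
  - rewrite IH.
    destruct (Z.leb_spec 0 (Z.of_nat n + z)), (Z.ltb_spec (Z.of_nat n + z) (Z.of_nat m));
      simpl andb; cbv iota; rewrite <- plus_IZR; f_equal; lia.
Qed.

(* [tri_poly] is a convex combination of characters agreeing with the hat function
   [max(0, 1 - |z| / m)] at integers; see [tri_poly_int]. *)
Section Triangle.

Variables m r : nat.
Let Q := (2 * r + 1)%nat.

(** The characters of the cyclic group of odd order [Q], centred so that every frequency lies in
    [[-PI, PI]], where the cosine decreases with the absolute value. *)
Definition tri_freq (j : nat) : R := 2 * PI * (INR j - INR r) / INR Q.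

(** The Fejér kernel on the cyclic group: as a square it is nonnegative, and its Fourier transform
    is the autocorrelation of an interval, that is, a hat. *)
Definition tri_weight (j : nat) : R :=
  Cmod (csum (fun k => cis (tri_freq j * INR k)) m) ^ 2 / (INR m * INR Q).

Definition tri_poly (y : R) : C :=
  csum (fun j => RtoC (tri_weight j) * cis (tri_freq j * y))%C Q.

Hypothesis Hm : (0 < m)%nat.

Lemma tri_Q_pos : 0 < INR Q.
Proof. apply (lt_INR 0). unfold Q; lia. Qed.

Lemma tri_m_pos : 0 < INR m.
Proof. apply (lt_INR 0). exact Hm. Qed.

Lemma tri_freq_abs j : (j < Q)%nat -> Rabs (tri_freq j) <= PI.
Proof.
  intros Hj. pose proof PI_RGT_0. pose proof tri_Q_pos as HQ. unfold tri_freq.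
  assert (H1 : Rabs (INR j - INR r) <= INR Q / 2).
  { unfold Q. rewrite plus_INR, mult_INR. simpl (INR 1); simpl (INR 2).
    assert (INR j <= 2 * INR r).
    { replace (2 * INR r) with (INR (2 * r)) by (rewrite mult_INR; reflexivity).
      apply le_INR. unfold Q in Hj; lia. }
    pose proof (pos_INR j). pose proof (pos_INR r). apply Rabs_le; lra. }
  replace (2 * PI * (INR j - INR r) / INR Q) with ((2 * PI / INR Q) * (INR j - INR r))
    by (field; lra).
  rewrite Rabs_mult, (Rabs_pos_eq (2 * PI / INR Q)) by (apply Rlt_le, Rdiv_lt_0_compat; lra).
  replace PI with ((2 * PI / INR Q) * (INR Q / 2)) at 2 by (field; lra).
  apply Rmult_le_compat_l; [apply Rlt_le, Rdiv_lt_0_compat; lra|exact H1].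
Qed.

Lemma tri_weight_nonneg j : 0 <= tri_weight j.
Proof.
  unfold tri_weight. pose proof tri_Q_pos. pose proof tri_m_pos.
  apply Rdiv_le_0_compat; [apply pow2_ge_0|nra].
Qed.

Lemma tri_orthogonality z :
  (Z.abs z < Z.of_nat Q)%Z ->
  csum (fun j => cis (tri_freq j * IZR z)) Q =
  RtoC (if Z.eqb z 0 then INR Q else 0).
Proof.
  intros Hz. pose proof tri_Q_pos as HQ. destruct (Z.eqb_spec z 0) as [->|Hnz].
  - rewrite (csum_ext _ (fun _ => RtoC 1)), csum_const; [ring|].
    intros; rewrite Rmult_0_r; apply cis_0.
  - rewrite (csum_ext _ (fun j => cis (INR j * (2 * PI * IZR z / INR Q)) *
                                  cis (- (2 * PI * INR r / INR Q) * IZR z))%C).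
    + rewrite csum_scal_r, roots_of_unity_sum by lia. ring.
    + intros j _. rewrite <- cis_add. f_equal. unfold tri_freq. field. lra.
Qed.

(** Expanding the square in [tri_weight] produces characters at [k - k' + z]; orthogonality keeps
    the pairs with [k' = k + z], which [count_window] counts. The hypothesis holds [|k - k' + z|]
    below [Q], so nothing wraps around. *)
Lemma tri_poly_int z :
  (Z.of_nat m + Z.abs z <= Z.of_nat Q)%Z ->
  tri_poly (IZR z) = RtoC (IZR (Z.max 0 (Z.of_nat m - Z.abs z)) / INR m).
Proof.
  intros Hz. pose proof tri_Q_pos as HQ. pose proof tri_m_pos as Hmp. unfold tri_poly.
  rewrite (csum_ext _ (fun j => RtoC (/ (INR m * INR Q)) *
    csum (fun k => csum (fun k' =>
      cis (tri_freq j * IZR (Z.of_nat k - Z.of_nat k' + z))) m) m)%C).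
  2:{ intros j _. unfold tri_weight, Rdiv.
      rewrite RtoC_mult, (Rmult_comm (INR m)), Cmod2_conj.
      set (c := RtoC (/ (INR Q * INR m))).
      rewrite (csum_ext (fun k => csum _ m)
        (fun k => cis (tri_freq j * INR k) *
                  (Cconj (csum (fun k' => cis (tri_freq j * INR k')) m) *
                   cis (tri_freq j * IZR z)))%C).
      - rewrite csum_scal_r. ring.
      - intros k _.
        rewrite (csum_ext _ (fun k' => cis (tri_freq j * INR k) *
           (Cconj (cis (tri_freq j * INR k')) * cis (tri_freq j * IZR z)))%C).
        + rewrite csum_scal, csum_scal_r. f_equal. f_equal.
          symmetry; apply Cconj_csum.
        + intros k' _. rewrite <- cis_opp, <- !cis_add. f_equal.
          rewrite plus_IZR, minus_IZR, <- !INR_IZR_INZ. ring. }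
  rewrite csum_scal, csum_swap.
  rewrite (csum_ext _ (fun k => RtoC (INR Q *
     (if (Z.leb 0 (Z.of_nat k + z) && Z.ltb (Z.of_nat k + z) (Z.of_nat m))%bool
      then 1 else 0)))).
  - rewrite csum_RtoC, rsum_scal, count_window, <- RtoC_mult. f_equal.
    replace (Z.min (Z.of_nat m) (Z.of_nat m - z) - Z.max 0 (- z))%Z
      with (Z.of_nat m - Z.abs z)%Z by lia.
    field. lra.
  - intros k Hk. rewrite csum_swap.
    rewrite (csum_ext _ (fun k' => RtoC (INR Q *
       (if Z.eqb (Z.of_nat k') (Z.of_nat k + z) then 1 else 0)))).
    + rewrite csum_RtoC, rsum_scal, count_eq. reflexivity.
    + intros k' Hk'. rewrite tri_orthogonality by lia. f_equal.
      destruct (Z.eqb_spec (Z.of_nat k - Z.of_nat k' + z) 0),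
        (Z.eqb_spec (Z.of_nat k') (Z.of_nat k + z)); try lia; ring.
Qed.

Hypothesis HmQ : (m < Q)%nat.

Lemma tri_weight_sum : rsum tri_weight Q = 1.
Proof.
  pose proof tri_m_pos. pose proof (tri_poly_int 0) as H0.
  specialize (H0 ltac:(lia)). unfold tri_poly in H0.
  rewrite (csum_ext _ (fun j => RtoC (tri_weight j))), csum_RtoC in H0.
  - apply RtoC_inj in H0. rewrite H0.
    replace (Z.max 0 (Z.of_nat m - Z.abs 0)) with (Z.of_nat m) by lia.
    rewrite <- INR_IZR_INZ. field. lra.
  - intros j _. simpl. rewrite Rmult_0_r, cis_0. ring.
Qed.

(** The hat takes the value [1 - 1/m] at [1], so the weighted mean of [|cis (tri_freq j) - 1|^2] is
    [2/m]: the weights concentrate near frequency [0]. *)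
Lemma tri_weight_cos : rsum (fun j => tri_weight j * (2 - 2 * cos (tri_freq j))) Q = 2 / INR m.
Proof.
  pose proof tri_m_pos. pose proof (tri_poly_int 1) as H1.
  specialize (H1 ltac:(lia)). unfold tri_poly in H1.
  apply (f_equal Re) in H1.
  assert (HRe : forall (u : nat -> C) n, Re (csum u n) = rsum (fun k => Re (u k)) n).
  { intros u n. induction n as [|n IH]; cbn [csum rsum]; [reflexivity|].
    rewrite <- IH. reflexivity. }
  rewrite HRe in H1. simpl in H1.
  rewrite (rsum_ext _ (fun j => 2 * tri_weight j + (-2) * (tri_weight j * cos (tri_freq j))))
    by (intros; ring).
  rewrite rsum_add, !rsum_scal, tri_weight_sum.
  rewrite (rsum_ext _ (fun j => tri_weight j * cos (tri_freq j))) in H1.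
  - rewrite H1. replace (Z.max 0 (Z.of_nat m - 1)) with (Z.of_nat m - 1)%Z by lia.
    rewrite minus_IZR, <- INR_IZR_INZ. field. lra.
  - intros j _. rewrite Rmult_1_r. ring.
Qed.

(* As [|tri_freq j| <= PI], [cos (tri_freq j * u) >= cos (tri_freq j)] for [|u| <= 1], so the
   oscillation over a unit interval is controlled by the exact value at [1]. *)
Lemma tri_poly_near e y z :
  0 < e -> 2 <= e * e * INR m -> Rabs (y - z) <= 1 ->
  Cmod (tri_poly y - tri_poly z)%C <= e.
Proof.
  intros He Hem Hyz. pose proof tri_m_pos as Hmp. unfold tri_poly. rewrite <- csum_sub.
  eapply Rle_trans.
  - apply (Cmod_csum_le _ (fun j => (e / 2) * tri_weight j +
      (/ (2 * e)) * (tri_weight j * (2 - 2 * cos (tri_freq j))))).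
    intros j Hj.
    replace (RtoC (tri_weight j) * cis (tri_freq j * y) -
             RtoC (tri_weight j) * cis (tri_freq j * z))%C
      with (RtoC (tri_weight j) *
            (cis (tri_freq j * z) * (cis (tri_freq j * (y - z)) - 1)))%C.
    2:{ replace (cis (tri_freq j * y))
          with (cis (tri_freq j * z) * cis (tri_freq j * (y - z)))%C; [ring|].
        rewrite <- cis_add. f_equal. ring. }
    rewrite !Cmod_mult, Cmod_cis, Rmult_1_l, Cmod_RtoC_nonneg by apply tri_weight_nonneg.
    set (d := Cmod (cis (tri_freq j * (y - z)) - 1)%C).
    assert (Hd : d ^ 2 <= 2 - 2 * cos (tri_freq j)).
    { unfold d. rewrite Cmod_cis_sub_1.
      assert (cos (tri_freq j) <= cos (tri_freq j * (y - z))); [|lra].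
      assert (Hcos : forall x, cos (Rabs x) = cos x).
      { intros x. unfold Rabs. destruct (Rcase_abs x); [apply cos_neg|reflexivity]. }
      rewrite <- (Hcos (tri_freq j)), <- (Hcos (tri_freq j * _)), Rabs_mult.
      pose proof (tri_freq_abs j Hj). pose proof (Rabs_pos (tri_freq j)).
      pose proof (Rabs_pos (y - z)). pose proof PI_RGT_0.
      apply cos_decr_1; nra. }
    assert (Hd0 : 0 <= d) by apply Cmod_ge_0.
    (* The inequality [d <= e/2 + d^2/(2e)] trades the first moment for the second, whose mean is
       known exactly. *)
    assert (d <= e / 2 + / (2 * e) * (2 - 2 * cos (tri_freq j))).
    { apply Rle_trans with (e / 2 + / (2 * e) * d ^ 2).
      - assert (0 <= / (2 * e) * (d - e) ^ 2).
        { apply Rmult_le_pos; [apply Rlt_le, Rinv_0_lt_compat; lra|apply pow2_ge_0]. }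
        replace (e / 2 + / (2 * e) * d ^ 2) with (d + / (2 * e) * (d - e) ^ 2)
          by (field; lra). lra.
      - apply Rplus_le_compat_l, Rmult_le_compat_l; [apply Rlt_le, Rinv_0_lt_compat; lra|].
        exact Hd. }
    pose proof (tri_weight_nonneg j).
    replace (e / 2 * tri_weight j + / (2 * e) * (tri_weight j * (2 - 2 * cos (tri_freq j))))
      with (tri_weight j * (e / 2 + / (2 * e) * (2 - 2 * cos (tri_freq j)))) by (field; lra).
    apply Rmult_le_compat_l; assumption.
  - rewrite rsum_add, !rsum_scal, tri_weight_sum, tri_weight_cos.
    assert (/ (2 * e) * (2 / INR m) <= e / 2); [|lra].
    apply (Rmult_le_reg_r (2 * e * INR m)); [nra|].
    replace (/ (2 * e) * (2 / INR m) * (2 * e * INR m)) with 2 by (field; lra).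
    replace (e / 2 * (2 * e * INR m)) with (e * e * INR m) by field. lra.
Qed.

End Triangle.

Lemma finite_bound (u : nat -> R) n : exists X, 0 <= X /\ forall k, (k < n)%nat -> Rabs (u k) <= X.
Proof.
  induction n as [|n [X [HX H]]]; [exists 0; split; [lra|intros; lia]|].
  exists (X + Rabs (u n)). pose proof (Rabs_pos (u n)). split; [lra|].
  intros k Hk. destruct (Nat.eq_dec k n) as [->|]; [lra|].
  specialize (H k ltac:(lia)). lra.
Qed.

(** After scaling by [c = m / a], the hat of height [a] is [a] times [tri_poly] at integers, and
    [tri_poly] is an average of characters, each of which only selects a value of [t] in the
    hypothesis. Replacing [lam n * c] by an integer within distance [1] costs [O(e)], and [e] is
    arbitrary. *)
Lemma hat_multiplier_bound (b : nat -> C) (lam : nat -> R) (N : nat) (M a : R) :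
  0 <= a ->
  (forall t, Cmod (csum (fun n => b n * cis (lam n * t))%C N) <= M) ->
  Cmod (csum (fun n => b n * RtoC (Rmax 0 (a - Rabs (lam n))))%C N) <= a * M.
Proof.
  intros Ha HM.
  destruct (Rle_lt_or_eq_dec 0 a Ha) as [Hap|<-].
  2:{ rewrite (csum_ext _ (fun _ => RtoC 0)), csum_zero, Cmod_0; [lra|].
      intros k _. rewrite Rmax_left by (pose proof (Rabs_pos (lam k)); lra). ring. }
  set (B := rsum (fun n => Cmod (b n)) N).
  assert (HB : 0 <= B) by (apply rsum_nonneg; intros; apply Cmod_ge_0).
  apply (le_of_forall_eps _ _ (2 * a * B)); [nra|]. intros e He.
  destruct (finite_bound lam N) as [X [HX HXb]].
  (* [m >= 2 / e^2] is what [tri_poly_near] asks for, and [m >= 1 / e] makes a hat of slope [1 / m]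
     vary by at most [e] over a unit interval. *)
  destruct (le_INR_exists (2 / (e * e) + / e + 1)) as [m Hm].
  assert (Hie : 0 < / e) by (apply Rinv_0_lt_compat; lra).
  assert (Hiee : 0 < 2 / (e * e)) by (apply Rdiv_lt_0_compat; nra).
  assert (Hmp : 0 < INR m) by lra.
  assert (Hm0 : (0 < m)%nat) by (apply INR_lt; exact Hmp).
  (* [r'] dominates every rounded argument; adding [m] keeps these integers in the range where
     [tri_poly_int] is exact. *)
  destruct (le_INR_exists (X * INR m / a + 1)) as [r' Hr'].
  set (r := (r' + m)%nat).
  set (c := INR m / a).
  assert (Hcp : 0 < c) by (apply Rdiv_lt_0_compat; lra).
  assert (HW : Cmod (csum (fun n => b n * tri_poly m r (lam n * c))%C N) <= M).
  { unfold tri_poly.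
    rewrite (csum_ext _ (fun n => csum (fun j => RtoC (tri_weight m r j) *
        (b n * cis (lam n * (tri_freq r j * c))))%C (2 * r + 1))).
    - rewrite csum_swap.
      rewrite <- (Rmult_1_l M), <- (tri_weight_sum m r) by (unfold r; lia).
      rewrite <- rsum_scal_r. apply Cmod_csum_le. intros j _.
      rewrite csum_scal, Cmod_mult, Cmod_RtoC_nonneg by (apply tri_weight_nonneg; lia).
      apply Rmult_le_compat_l; [apply tri_weight_nonneg; lia|apply HM].
    - intros n _. rewrite <- csum_scal. apply csum_ext. intros j _.
      replace (tri_freq r j * (lam n * c)) with (lam n * (tri_freq r j * c)) by ring. ring. }
  assert (Hdiff : Cmod (csum (fun n => b n * RtoC (Rmax 0 (a - Rabs (lam n))))%C N -
                        RtoC a * csum (fun n => b n * tri_poly m r (lam n * c))%C N)%C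
                  <= 2 * a * B * e).
  { rewrite <- csum_scal, <- csum_sub.
    replace (2 * a * B * e) with (rsum (fun n => Cmod (b n) * (2 * a * e)) N).
    2:{ rewrite rsum_scal_r. unfold B. ring. }
    apply Cmod_csum_le. intros n Hn.
    set (y := lam n * c).
    destruct (archimed y) as [Hz1 Hz2]. set (z := up y) in *.
    assert (Hy : Rabs y <= X * INR m / a).
    { unfold y. rewrite Rabs_mult, (Rabs_pos_eq c) by lra.
      replace (X * INR m / a) with (X * c) by (unfold c; field; lra).
      apply Rmult_le_compat_r; [lra|apply HXb, Hn]. }
    assert (Hyz : Rabs (y - IZR z) <= 1) by (apply Rabs_le; lra).
    assert (Hzr : (Z.abs z <= Z.of_nat r')%Z).
    { apply le_IZR. rewrite <- INR_IZR_INZ, <- Rabs_Zabs.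
      pose proof (Rabs_triang_inv (IZR z) y). rewrite Rabs_minus_sym in Hyz. lra. }
    assert (Hnear : Cmod (tri_poly m r y - tri_poly m r (IZR z))%C <= e).
    { apply tri_poly_near; auto; [unfold r; lia|].
      apply (Rmult_le_reg_r (/ (e * e))); [apply Rinv_0_lt_compat; nra|].
      replace (e * e * INR m * / (e * e)) with (INR m) by (field; lra).
      unfold Rdiv in Hm. unfold Rdiv in Hiee. lra. }
    rewrite (tri_poly_int m r Hm0 z) in Hnear by (unfold r; lia).
    replace (b n * RtoC (Rmax 0 (a - Rabs (lam n))) -
             RtoC a * (b n * tri_poly m r y))%C
      with (b n * ((RtoC (Rmax 0 (a - Rabs (lam n)) -
                      a * (IZR (Z.max 0 (Z.of_nat m - Z.abs z)) / INR m))) +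
                   RtoC a * (RtoC (IZR (Z.max 0 (Z.of_nat m - Z.abs z)) / INR m) -
                             tri_poly m r y)))%C.
    2:{ rewrite RtoC_minus, (RtoC_mult a). ring. }
    rewrite Cmod_mult. apply Rmult_le_compat_l; [apply Cmod_ge_0|].
    eapply Rle_trans; [apply Cmod_triangle|].
    rewrite Cmod_mult, (Cmod_RtoC_nonneg a), Cmod_R by lra.
    rewrite Cmod_sub_sym in Hnear.
    assert (Hh : Rabs (Rmax 0 (a - Rabs (lam n)) -
                  a * (IZR (Z.max 0 (Z.of_nat m - Z.abs z)) / INR m)) <= a * e).
    { assert (Hlam : Rabs (lam n) = a * (Rabs y / INR m)).
      { unfold y. rewrite Rabs_mult, (Rabs_pos_eq c) by lra. unfold c. field; lra. }
      assert (Hmax : IZR (Z.max 0 (Z.of_nat m - Z.abs z)) = Rmax 0 (INR m - Rabs (IZR z))).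
      { rewrite INR_IZR_INZ, Rabs_Zabs, <- minus_IZR.
        destruct (Z.max_spec 0 (Z.of_nat m - Z.abs z)) as [[H1 ->]|[H1 ->]].
        - rewrite Rmax_right; [reflexivity|]. apply IZR_le; lia.
        - rewrite Rmax_left; [reflexivity|]. apply IZR_le; lia. }
      rewrite Hmax, Hlam.
      assert (Hyz' : Rabs (Rabs y - Rabs (IZR z)) <= 1)
        by (eapply Rle_trans; [apply Rabs_triang_inv2|exact Hyz]).
      apply Rabs_le_between in Hyz'.
      replace (Rmax 0 (a - a * (Rabs y / INR m)))
        with (a * (Rmax 0 (INR m - Rabs y) / INR m)).
      2:{ unfold Rdiv. rewrite (Rmult_comm (Rmax _ _)), <- Rmult_assoc.
          rewrite <- RmaxRmult.
          2:{ apply Rmult_le_pos; [lra|apply Rlt_le, Rinv_0_lt_compat; lra]. }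
          f_equal; [ring|field; lra]. }
      replace (a * (Rmax 0 (INR m - Rabs y) / INR m) - a * (Rmax 0 (INR m - Rabs (IZR z)) / INR m))
        with (a * / INR m * (Rmax 0 (INR m - Rabs y) - Rmax 0 (INR m - Rabs (IZR z))))
        by (field; lra).
      rewrite !Rabs_mult, (Rabs_pos_eq a), Rabs_inv, (Rabs_pos_eq (INR m)) by lra.
      assert (Rabs (Rmax 0 (INR m - Rabs y) - Rmax 0 (INR m - Rabs (IZR z))) <= 1).
      { unfold Rmax. destruct (Rle_dec 0 (INR m - Rabs y)), (Rle_dec 0 (INR m - Rabs (IZR z)));
          apply Rabs_le; lra. }
      assert (/ INR m <= e).
      { rewrite <- (Rinv_inv e). apply Rinv_le_contravar; lra. }
      assert (0 < / INR m) by (apply Rinv_0_lt_compat; lra).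
      pose proof (Rabs_pos (Rmax 0 (INR m - Rabs y) - Rmax 0 (INR m - Rabs (IZR z)))).
      rewrite Rmult_assoc. apply Rmult_le_compat_l; [lra|]. nra. }
    assert (a * Cmod (RtoC (IZR (Z.max 0 (Z.of_nat m - Z.abs z)) / INR m) - tri_poly m r y)%C
            <= a * e) by (apply Rmult_le_compat_l; [lra|exact Hnear]).
    lra. }
  eapply Rle_trans; [apply Cmod_triangle_sub|].
  apply Rplus_le_compat; [|exact Hdiff].
  rewrite Cmod_mult, Cmod_RtoC_nonneg by lra. apply Rmult_le_compat_l; lra.
Qed.

(** * Partial sums of Dirichlet polynomials *)

Lemma Cexp_polar z : Cexp z = (RtoC (exp (Re z)) * cis (Im z))%C.
Proof. unfold Cexp, cis, RtoC, Cmult; simpl. f_equal; ring. Qed.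

Lemma Cexp_add z w : Cexp (z + w)%C = (Cexp z * Cexp w)%C.
Proof.
  rewrite !Cexp_polar.
  change (Re (z + w)%C) with (Re z + Re w). change (Im (z + w)%C) with (Im z + Im w).
  rewrite exp_plus, cis_add, RtoC_mult. ring.
Qed.

Lemma Cmod_Cexp z : Cmod (Cexp z) = exp (Re z).
Proof.
  rewrite Cexp_polar, Cmod_mult, Cmod_cis, Cmod_RtoC_nonneg; [ring|].
  apply Rlt_le, exp_pos.
Qed.

Lemma npow_neg_polar n (s : C) :
  npow_neg n s = (RtoC (exp (- (Re s * ln (INR n)))) * cis (- (Im s * ln (INR n))))%C.
Proof.
  unfold npow_neg. rewrite Cexp_polar. unfold Re, Im; simpl. do 3 f_equal; ring.
Qed.

Lemma npow_neg_add n s t : npow_neg n (s + t)%C = (npow_neg n s * npow_neg n t)%C.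
Proof. unfold npow_neg. rewrite <- Cexp_add. f_equal. ring. Qed.

Lemma npow_neg_real n x : npow_neg n (RtoC x) = RtoC (exp (- (x * ln (INR n)))).
Proof.
  rewrite npow_neg_polar. simpl. rewrite Rmult_0_l, Ropp_0, cis_0. ring.
Qed.

Lemma Cmod_npow_neg n s : Cmod (npow_neg n s) = exp (- (Re s * ln (INR n))).
Proof.
  rewrite npow_neg_polar, Cmod_mult, Cmod_cis, Cmod_RtoC_nonneg; [ring|].
  apply Rlt_le, exp_pos.
Qed.

Lemma npow_neg_mult m n s :
  (1 <= m)%nat -> (1 <= n)%nat -> npow_neg (m * n) s = (npow_neg m s * npow_neg n s)%C.
Proof.
  intros Hm Hn. unfold npow_neg. rewrite <- Cexp_add. f_equal.
  rewrite mult_INR, ln_mult, RtoC_plus by (apply (lt_INR 0); lia). ring.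
Qed.

Lemma npow_neg_1 s : npow_neg 1 s = RtoC 1.
Proof.
  rewrite npow_neg_polar. simpl INR. rewrite ln_1, !Rmult_0_r, Ropp_0, exp_0, cis_0. ring.
Qed.

Definition log_S (k : nat) : R := ln (INR (S k)).

Lemma INR_S_pos k : 0 < INR (S k).
Proof. apply (lt_INR 0). lia. Qed.

Lemma log_S_le j k : (j <= k)%nat -> log_S j <= log_S k.
Proof.
  intros H. unfold log_S. apply ln_le; [apply INR_S_pos|]. apply le_INR. lia.
Qed.

Lemma log_S_nonneg k : 0 <= log_S k.
Proof.
  replace 0 with (log_S 0) by (unfold log_S; simpl; apply ln_1). apply log_S_le. lia.
Qed.

Lemma exp_log_S k : exp (log_S k) = INR (S k).
Proof. apply exp_ln, INR_S_pos. Qed.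

(** A ramp separating two consecutive logarithms can be at least this wide, so [O(log k)] halvings
    of the width suffice to reach it. *)
Lemma log_S_gap k : / INR (S (S k)) <= log_S (S k) - log_S k.
Proof.
  pose proof (INR_S_pos k) as H1. pose proof (INR_S_pos (S k)) as H2.
  unfold log_S. rewrite <- ln_div by assumption.
  assert (H : 1 + (- ln (INR (S (S k)) / INR (S k))) <=
              exp (- ln (INR (S (S k)) / INR (S k)))) by apply exp_ineq1_le.
  rewrite exp_Ropp, exp_ln in H by (apply Rdiv_lt_0_compat; assumption).
  rewrite Rinv_div in H.
  replace (INR (S k) / INR (S (S k))) with (1 - / INR (S (S k))) in H; [lra|].
  rewrite (S_INR (S k)) in *. field. lra.
Qed.

Definition dsum (a : nat -> C) (s : C) (n : nat) : C :=
  csum (fun k => a (S k) * npow_neg (S k) s)%C n.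

(** A trapezoidal cut-off. When [w] is the gap from [L] to the next logarithm of an integer, it acts
    on those logarithms as the indicator of an initial segment. *)
Definition ramp (L w x : R) : R := Rmax 0 (Rmin 1 ((L + w - x) / w)).

(** All the functions are piecewise linear with kinks at most at [L], [L + w] and [L + 2w]; the
    proof checks the four resulting intervals. *)
Lemma ramp_double L w x : 0 < w ->
  ramp L w x = ramp L (2 * w) x - / (2 * w) * Rmax 0 (w - Rabs (x - (L + w))).
Proof.
  intros Hw. unfold ramp.
  assert (Hi : 0 < / (2 * w)) by (apply Rinv_0_lt_compat; lra).
  replace ((L + w - x) / w) with (1 + 2 * ((L - x) * / (2 * w))) by (field; lra).
  replace ((L + 2 * w - x) / (2 * w)) with (1 + (L - x) * / (2 * w)) by (field; lra).
  set (i := / (2 * w)) in *.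
  assert (Hiw : i * w = / 2) by (unfold i; field; lra).
  set (d := (L - x)). replace (x - (L + w)) with (- (d + w)) by (unfold d; ring).
  rewrite Rabs_Ropp.
  destruct (Rle_lt_dec 0 d) as [H1|H1].
  { assert (0 <= d * i) by nra.
    rewrite (Rabs_pos_eq (d + w)), (Rmax_left 0 (w - (d + w))) by lra.
    rewrite !Rmin_left by lra. ring. }
  assert (d * i < 0) by nra.
  rewrite !(Rmin_right 1) by lra.
  destruct (Rle_lt_dec (- w) d) as [H2|H2].
  { rewrite (Rabs_pos_eq (d + w)) by lra.
    rewrite !(Rmax_right 0) by nra. lra. }
  rewrite (Rabs_left (d + w)) by lra.
  destruct (Rle_lt_dec (- 2 * w) d) as [H3|H3].
  - rewrite (Rmax_left 0 (1 + 2 * _)), !(Rmax_right 0) by nra. nra.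
  - rewrite !(Rmax_left 0) by nra. ring.
Qed.

(** On the positive axis a trapezoid is a difference of two centred hats. Their total cost is
    [(2L + w) / w], at most [3] when [L <= w], which starts the halving. *)
Lemma ramp_wide L w x : 0 < w -> 0 <= L -> 0 <= x ->
  ramp L w x = / w * Rmax 0 (L + w - Rabs (x - 0)) - / w * Rmax 0 (L - Rabs (x - 0)).
Proof.
  intros Hw HL Hx. unfold ramp. rewrite Rminus_0_r, (Rabs_pos_eq x) by lra.
  assert (Hi : 0 < / w) by (apply Rinv_0_lt_compat; lra).
  assert (Hiw : / w * w = 1) by (field; lra).
  replace ((L + w - x) / w) with (1 + / w * (L - x)) by (field; lra).
  destruct (Rle_lt_dec x L).
  { rewrite Rmin_left by nra. rewrite !(Rmax_right 0) by lra. nra. }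
  rewrite Rmin_right by nra. rewrite (Rmax_left 0 (L - x)) by lra.
  destruct (Rle_lt_dec x (L + w)).
  - rewrite !(Rmax_right 0) by nra. nra.
  - rewrite !(Rmax_left 0) by nra. ring.
Qed.

Lemma ramp_1 L w x : 0 < w -> x <= L -> ramp L w x = 1.
Proof.
  intros Hw H. unfold ramp.
  assert (1 <= (L + w - x) / w) by (apply Rle_div_r; lra).
  rewrite Rmin_left, Rmax_right; lra.
Qed.

Lemma ramp_0 L w x : 0 < w -> L + w <= x -> ramp L w x = 0.
Proof.
  intros Hw H. unfold ramp.
  assert ((L + w - x) / w <= 0) by (apply Rle_div_l; lra).
  rewrite Rmin_right, Rmax_left; lra.
Qed.

Section PartialSums.

Variables (a : nat -> C) (N : nat) (M : R).
Hypothesis Hbound : forall s : C, 0 < Re s -> Cmod (dsum a s N) <= M.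

Lemma dirichlet_bound_nonneg : 0 <= M.
Proof.
  eapply Rle_trans; [apply Cmod_ge_0|]. apply (Hbound (RtoC 1)). simpl. lra.
Qed.

Definition log_multiplier (s : C) (phi : R -> R) : C :=
  csum (fun k => a (S k) * npow_neg (S k) s * RtoC (phi (log_S k)))%C N.

(** A twist by [cis (x * t)] at [x = log n] moves [s] vertically by [-t], where [Hbound] still
    applies; the centre [x0] only contributes a unimodular constant. *)
Lemma log_multiplier_hat (s : C) h x0 : 0 < Re s -> 0 <= h ->
  Cmod (log_multiplier s (fun x => Rmax 0 (h - Rabs (x - x0)))) <= h * M.
Proof.
  intros Hs Hh. unfold log_multiplier.
  apply (hat_multiplier_bound (fun k => a (S k) * npow_neg (S k) s)%C
           (fun k => log_S k - x0) N M h Hh).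
  intros t.
  rewrite (csum_ext _ (fun k => cis (- (x0 * t)) *
            (a (S k) * npow_neg (S k) (s + (0%R, (- t)%R))))%C).
  - rewrite csum_scal, Cmod_mult, Cmod_cis, Rmult_1_l. apply Hbound. simpl. unfold Re in Hs. lra.
  - intros k _. rewrite npow_neg_add, (npow_neg_polar _ (0%R, (- t)%R)). simpl Re; simpl Im.
    rewrite Rmult_0_l, Ropp_0, exp_0.
    replace (cis ((log_S k - x0) * t))
      with (cis (- (x0 * t)) * cis (- (- t * ln (INR (S k)))))%C; [ring|].
    rewrite <- cis_add. f_equal. unfold log_S. ring.
Qed.

Lemma log_multiplier_lin s phi psi chi c d :
  (forall k, phi (log_S k) = c * psi (log_S k) + d * chi (log_S k)) ->
  log_multiplier s phi =
  (RtoC c * log_multiplier s psi + RtoC d * log_multiplier s chi)%C.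
Proof.
  intros H. unfold log_multiplier. rewrite <- !csum_scal, <- csum_add.
  apply csum_ext. intros k _. rewrite H, RtoC_plus, !RtoC_mult. ring.
Qed.

(* Halving the width of a ramp costs one hat of norm [1/2], so a ramp of relative width
   [2^-K] costs only [O(K)]; this is where the logarithm comes from. *)
Lemma log_multiplier_ramp (s : C) L : 0 < Re s -> 0 <= L ->
  forall K w, 0 < w -> L <= 2 ^ K * w ->
  Cmod (log_multiplier s (ramp L w)) <= (3 + INR K / 2) * M.
Proof.
  intros Hs HL. pose proof dirichlet_bound_nonneg as HM.
  induction K as [|K IH]; intros w Hw HK.
  - simpl in HK.
    assert (Hi : 0 < / w) by (apply Rinv_0_lt_compat; lra).
    rewrite (log_multiplier_lin s (ramp L w) (fun x => Rmax 0 (L + w - Rabs (x - 0)))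
              (fun x => Rmax 0 (L - Rabs (x - 0))) (/ w) (- / w)).
    2:{ intros k. rewrite ramp_wide by (try assumption; apply log_S_nonneg). ring. }
    eapply Rle_trans; [apply Cmod_triangle|].
    rewrite !Cmod_mult, !Cmod_R, Rabs_Ropp, (Rabs_pos_eq (/ w)) by lra.
    assert (H1 := log_multiplier_hat s (L + w) 0 Hs ltac:(lra)).
    assert (H2 := log_multiplier_hat s L 0 Hs HL).
    apply (Rmult_le_compat_l (/ w)) in H1, H2; try lra.
    assert (/ w * ((L + w) * M) + / w * (L * M) <= 3 * M); [|simpl; lra].
    replace (/ w * ((L + w) * M) + / w * (L * M)) with ((2 * (L / w) + 1) * M) by (field; lra).
    apply Rmult_le_compat_r; [exact HM|].
    assert (L / w <= 1) by (apply Rle_div_l; lra). lra.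
  - assert (Hi : 0 < / (2 * w)) by (apply Rinv_0_lt_compat; lra).
    rewrite (log_multiplier_lin s (ramp L w) (ramp L (2 * w))
              (fun x => Rmax 0 (w - Rabs (x - (L + w)))) 1 (- / (2 * w))).
    2:{ intros k. rewrite (ramp_double L w) by assumption. ring. }
    eapply Rle_trans; [apply Cmod_triangle|].
    rewrite !Cmod_mult, !Cmod_R, Rabs_Ropp, Rabs_R1, (Rabs_pos_eq (/ (2 * w))) by lra.
    assert (H1 := IH (2 * w) ltac:(lra) ltac:(simpl in HK; lra)).
    assert (H2 := log_multiplier_hat s w (L + w) Hs ltac:(lra)).
    apply (Rmult_le_compat_l (/ (2 * w))) in H2; try lra.
    replace (/ (2 * w) * (w * M)) with (M / 2) in H2 by (field; lra).
    rewrite S_INR. lra.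
Qed.

(** With [w] the gap after [log (n + 1)], the ramp multiplier is the partial sum itself. The factor
    [O(log n)] it costs is traded for a power of exponent [eta] at the price [2 / eta], a form
    suited to Abel summation. *)
Lemma partial_sum_growth (eta : R) (s : C) n :
  0 < eta -> 0 < Re s -> (S n <= N)%nat ->
  Cmod (dsum a s (S n)) <= (4 + 2 / eta) * exp (eta * log_S n) * M.
Proof.
  intros Heta Hs HnN. pose proof dirichlet_bound_nonneg as HM.
  set (w := log_S (S n) - log_S n).
  pose proof (log_S_gap n) as Hgap. fold w in Hgap.
  pose proof (INR_S_pos (S n)) as HSS. pose proof (INR_S_pos n) as HSn.
  assert (Hw : 0 < w) by (pose proof (Rinv_0_lt_compat _ HSS); lra).
  pose proof (log_S_nonneg n) as HL.
  assert (Hlog : 1 + log_S n <= INR (S n)) by (rewrite <- exp_log_S; apply exp_ineq1_le).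
  destruct (Nat.log2_spec (S n) ltac:(lia)) as [Hl1 Hl2].
  set (l := Nat.log2 (S n)) in *.
  assert (Hpow : INR (S (S n)) <= 2 ^ S l).
  { replace 2 with (INR 2) by reflexivity. rewrite <- pow_INR. apply le_INR. lia. }
  (* [log (n + 1) <= n + 2 <= (n + 2)^2 w], and [n + 2 <= 2^(l + 1)]; so [2 (l + 1)] halvings reach
     the gap, at a cost of [3 + (l + 1)] times [M]. *)
  assert (HK : log_S n <= 2 ^ (2 * S l) * w).
  { apply Rle_trans with (INR (S (S n)) * INR (S (S n)) * w).
    - apply Rle_trans with (INR (S (S n)) * INR (S (S n)) * / INR (S (S n))).
      + replace (INR (S (S n)) * INR (S (S n)) * / INR (S (S n)))
          with (INR (S (S n))) by (field; lra).
        rewrite (S_INR (S n)). lra.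
      + apply Rmult_le_compat_l; [nra|exact Hgap].
    - apply Rmult_le_compat_r; [lra|].
      replace (2 * S l)%nat with (S l + S l)%nat by lia. rewrite pow_add.
      apply Rmult_le_compat; lra. }
  pose proof (log_multiplier_ramp s (log_S n) Hs HL (2 * S l) w Hw HK) as H.
  replace (log_multiplier s (ramp (log_S n) w)) with (dsum a s (S n)) in H.
  - eapply Rle_trans; [exact H|]. apply Rmult_le_compat_r; [exact HM|].
    rewrite mult_INR, (S_INR l). simpl (INR 2).
    assert (Hl : INR l <= 2 * log_S n).
    { assert (INR l * ln 2 <= log_S n).
      { rewrite <- ln_pow by lra. apply ln_le; [apply pow_lt; lra|].
        replace 2 with (INR 2) by reflexivity. rewrite <- pow_INR. apply le_INR. exact Hl1. }
      pose proof ln_lt_2. pose proof (pos_INR l). nra. }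
    assert (He : 1 + eta * log_S n <= exp (eta * log_S n)) by apply exp_ineq1_le.
    assert (H2e : 0 < 2 / eta) by (apply Rdiv_lt_0_compat; lra).
    assert (Hee : 2 / eta * (eta * log_S n) = 2 * log_S n) by (field; lra).
    assert (2 / eta * (1 + eta * log_S n) <= 2 / eta * exp (eta * log_S n))
      by (apply Rmult_le_compat_l; lra).
    assert (0 <= eta * log_S n) by nra.
    lra.
  - unfold log_multiplier, dsum. replace N with (S n + (N - S n))%nat by lia.
    rewrite (csum_split _ (S n)).
    rewrite (csum_ext (fun k => _ * RtoC (ramp _ _ (log_S (S n + k))))%C (fun _ => RtoC 0)).
    + rewrite csum_zero, Cplus_0_r. apply csum_ext. intros k Hk.
      rewrite ramp_1; [ring|exact Hw|]. apply log_S_le. lia.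
    + intros k _. rewrite ramp_0; [ring|exact Hw|].
      unfold w. pose proof (log_S_le (S n) (S n + k) ltac:(lia)). lra.
Qed.

End PartialSums.

Lemma csum_abel u v n :
  csum (fun k => u k * v k)%C (S n) =
  (csum (fun k => csum u (S k) * (v k - v (S k))) n + csum u (S n) * v n)%C.
Proof.
  induction n as [|n IH]; [cbn [csum]; ring|].
  cbn [csum] in *. rewrite IH. ring.
Qed.

(* Abel summation against [n^(-sigma)] absorbs the growth [n^(sigma/2)] of the partial sums. *)
Lemma partial_sum_shift_bound (a : nat -> C) (N : nat) (M sigma : R) (s : C) n :
  (forall s : C, 0 < Re s -> Cmod (dsum a s N) <= M) ->
  0 < sigma -> 0 < Re s -> (n <= N)%nat ->
  Cmod (dsum a (s + RtoC sigma)%C n) <= 2 * (4 + 4 / sigma) * M.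
Proof.
  intros Hb Hsig Hs HnN. pose proof (dirichlet_bound_nonneg a N M Hb) as HM.
  set (K := 4 + 4 / sigma).
  assert (HK : 4 <= K) by (unfold K; pose proof (Rdiv_lt_0_compat 4 sigma); lra).
  destruct n as [|n]; [unfold dsum; simpl; rewrite Cmod_0; nra|].
  set (A := fun k => exp (- (sigma / 2 * log_S k))).
  assert (HA : forall k, 0 < A k) by (intros; apply exp_pos).
  assert (HAd : forall k, A (S k) <= A k).
  { intros k. pose proof (log_S_le k (S k) ltac:(lia)). unfold A.
    destruct (Req_dec (log_S k) (log_S (S k))) as [->|]; [lra|].
    apply Rlt_le, exp_increasing. nra. }
  set (u := fun k => (a (S k) * npow_neg (S k) s)%C).
  set (v := fun k => RtoC (A k ^ 2)).
  assert (Hu : forall k, (S k <= N)%nat -> Cmod (csum u (S k)) <= K * / A k * M).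
  { intros k Hk.
    pose proof (partial_sum_growth a N M Hb (sigma / 2) s k ltac:(lra) Hs Hk) as H.
    replace (4 + 2 / (sigma / 2)) with K in H by (unfold K; field; lra).
    unfold A. rewrite exp_Ropp, Rinv_inv. exact H. }
  assert (Heq : dsum a (s + RtoC sigma)%C (S n) = csum (fun k => u k * v k)%C (S n)).
  { apply csum_ext. intros k _. unfold u, v, A.
    rewrite npow_neg_add, npow_neg_real, <- Cmult_assoc. do 2 f_equal.
    rewrite <- Rsqr_pow2. unfold Rsqr. rewrite <- exp_plus. do 2 f_equal.
    unfold log_S. field. }
  rewrite Heq, csum_abel.
  eapply Rle_trans; [apply Cmod_triangle|].
  assert (H1 : Cmod (csum (fun k => csum u (S k) * (v k - v (S k)))%C n)
               <= 2 * K * M * (A O - A n)).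
  { rewrite <- rsum_telescope, <- rsum_scal. apply Cmod_csum_le. intros k Hk.
    unfold v. rewrite <- RtoC_minus, Cmod_mult, Cmod_R.
    pose proof (HA k). pose proof (HA (S k)). pose proof (HAd k).
    rewrite Rabs_pos_eq by nra.
    (* In the factored difference of squares the sum [A k + A (S k)] cancels [/ A k] up to a factor
       [2], and the difference telescopes. *)
    apply Rle_trans with (K * / A k * M * (A k ^ 2 - A (S k) ^ 2)).
    - apply Rmult_le_compat_r; [nra|]. apply Hu. lia.
    - replace (K * / A k * M * (A k ^ 2 - A (S k) ^ 2))
        with (K * M * ((A k - A (S k)) * (1 + A (S k) / A k))) by (field; lra).
      assert (A (S k) / A k <= 1) by (apply Rle_div_l; lra).
      replace (2 * K * M * (A k - A (S k))) with (K * M * ((A k - A (S k)) * 2)) by ring.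
      apply Rmult_le_compat_l; [nra|]. apply Rmult_le_compat_l; lra. }
  assert (H2 : Cmod (csum u (S n) * v n)%C <= K * M * A n).
  { unfold v. pose proof (HA n). rewrite Cmod_mult, Cmod_R, Rabs_pos_eq by nra.
    apply Rle_trans with (K * / A n * M * A n ^ 2).
    - apply Rmult_le_compat_r; [nra|]. apply Hu. lia.
    - right. field. lra. }
  assert (HA0 : A O = 1).
  { unfold A, log_S. simpl INR. rewrite ln_1, Rmult_0_r, Ropp_0. apply exp_0. }
  pose proof (HA n). assert (0 <= K * M) by nra. rewrite HA0 in H1. nra.
Qed.

(** * Uniform limits of Dirichlet polynomials *)

Definition supported (A : nat -> Prop) (a : nat -> C) : Prop :=
  forall n, (1 <= n)%nat -> ~ A n -> a n = RtoC 0.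

Definition poly_coefs (A : nat -> Prop) (a : nat -> C) (N : nat) : Prop :=
  supported A a /\ forall n, (N < n)%nat -> a n = RtoC 0.

Definition dirichlet_poly (A : nat -> Prop) (F : C -> C) : Prop :=
  exists a N, poly_coefs A a N /\ forall s, F s = dsum a s N.

Definition close_on_C0 (F G : C -> C) (e : R) : Prop :=
  forall s : C, 0 < Re s -> Cmod (F s - G s)%C <= e.

Definition uniform_dirichlet (A : nat -> Prop) (F : C -> C) : Prop :=
  forall e, 0 < e -> exists P, dirichlet_poly A P /\ close_on_C0 F P e.

Lemma dsum_stable A a N n s : poly_coefs A a N -> (N <= n)%nat -> dsum a s n = dsum a s N.
Proof.
  intros [_ H] Hn. apply csum_tail_zero; [exact Hn|].
  intros k Hk. rewrite H by lia. ring.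
Qed.

Lemma dsum_sub a b s n : dsum (fun n => a n - b n)%C s n = (dsum a s n - dsum b s n)%C.
Proof.
  unfold dsum. rewrite <- csum_sub. apply csum_ext. intros. ring.
Qed.

Lemma dirichlet_poly_ext A F G :
  (forall s, F s = G s) -> dirichlet_poly A F -> dirichlet_poly A G.
Proof.
  intros H [a [N [Ha HF]]]. exists a, N. split; [exact Ha|].
  intros s. rewrite <- H. apply HF.
Qed.

Lemma dirichlet_poly_zero A : dirichlet_poly A (fun _ => RtoC 0).
Proof.
  exists (fun _ => RtoC 0), O. repeat split; auto.
Qed.

Lemma dirichlet_poly_add A F G :
  dirichlet_poly A F -> dirichlet_poly A G -> dirichlet_poly A (fun s => F s + G s)%C.
Proof.
  intros [a [N [Ha HF]]] [b [N' [Hb HG]]].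
  exists (fun n => a n + b n)%C, (max N N'). split; [split|].
  - intros n Hn HA. rewrite (proj1 Ha), (proj1 Hb) by assumption. ring.
  - intros n Hn. rewrite (proj2 Ha), (proj2 Hb) by lia. ring.
  - intros s. rewrite HF, HG.
    rewrite <- (dsum_stable A a N (max N N') s Ha), <- (dsum_stable A b N' (max N N') s Hb) by lia.
    unfold dsum. rewrite <- csum_add. apply csum_ext. intros. ring.
Qed.

Lemma dirichlet_poly_monomial (A : nat -> Prop) c n :
  (1 <= n)%nat -> A n -> dirichlet_poly A (fun s => c * npow_neg n s)%C.
Proof.
  intros Hn HA. destruct n as [|n]; [lia|].
  exists (fun k => if Nat.eqb k (S n) then c else RtoC 0), (S n). split; [split|].
  - intros k _ Hk. destruct (Nat.eqb_spec k (S n)) as [->|]; [contradiction|reflexivity].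
  - intros k Hk. destruct (Nat.eqb_spec k (S n)) as [->|]; [lia|reflexivity].
  - intros s. unfold dsum. rewrite (csum_single _ _ n).
    + rewrite Nat.eqb_refl. reflexivity.
    + lia.
    + intros i Hi Hin. destruct (Nat.eqb_spec (S i) (S n)); [lia|]. ring.
Qed.

Lemma dirichlet_poly_csum A (F : nat -> C -> C) n :
  (forall k, (k < n)%nat -> dirichlet_poly A (F k)) ->
  dirichlet_poly A (fun s => csum (fun k => F k s) n).
Proof.
  induction n as [|n IH]; intros H; [apply dirichlet_poly_zero|].
  cbn [csum]. apply dirichlet_poly_add; [apply IH; intros|]; apply H; lia.
Qed.

(** The one place where closure of [A] under products enters: pairs of indices not both in [A] carry
    a zero coefficient. *)
Lemma dirichlet_poly_mult A F G :
  mult_subsemigroup A ->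
  dirichlet_poly A F -> dirichlet_poly A G -> dirichlet_poly A (fun s => F s * G s)%C.
Proof.
  intros [_ HAm] [a [N [Ha HF]]] [b [N' [Hb HG]]].
  apply (dirichlet_poly_ext _ (fun s => csum (fun i => csum (fun j =>
     (a (S i) * b (S j)) * npow_neg (S i * S j) s)%C N') N)).
  - intros s. rewrite HF, HG. unfold dsum at 1. rewrite <- csum_scal_r.
    apply csum_ext. intros i _. unfold dsum. rewrite <- csum_scal.
    apply csum_ext. intros j _. rewrite npow_neg_mult by lia. ring.
  - apply dirichlet_poly_csum. intros i _. apply dirichlet_poly_csum. intros j _.
    assert (Hz : (a (S i) * b (S j))%C = RtoC 0 ->
      dirichlet_poly A (fun s => a (S i) * b (S j) * npow_neg (S i * S j) s)%C).
    { intros H. apply (dirichlet_poly_ext _ (fun _ => RtoC 0)); [|apply dirichlet_poly_zero].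
      intros s. rewrite H. ring. }
    destruct (classic (A (S i))) as [Hi|Hi].
    2:{ apply Hz. rewrite (proj1 Ha) by (assumption || lia). ring. }
    destruct (classic (A (S j))) as [Hj|Hj].
    2:{ apply Hz. rewrite (proj1 Hb) by (assumption || lia). ring. }
    apply dirichlet_poly_monomial; [lia|]. now apply HAm.
Qed.

Lemma Cmod_npow_neg_le_1 k (s : C) : 0 <= Re s -> Cmod (npow_neg (S k) s) <= 1.
Proof.
  intros Hs. rewrite Cmod_npow_neg, <- exp_0. pose proof (log_S_nonneg k) as H.
  unfold log_S in H. apply exp_mono. nra.
Qed.

Lemma dirichlet_poly_bounded A F :
  dirichlet_poly A F -> exists B, 0 <= B /\ forall s : C, 0 < Re s -> Cmod (F s) <= B.
Proof.
  intros [a [N [_ HF]]]. exists (rsum (fun k => Cmod (a (S k))) N). split.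
  - apply rsum_nonneg. intros. apply Cmod_ge_0.
  - intros s Hs. rewrite HF. apply Cmod_csum_le. intros k _.
    rewrite Cmod_mult. rewrite <- Rmult_1_r.
    apply Rmult_le_compat_l; [apply Cmod_ge_0|]. apply Cmod_npow_neg_le_1. lra.
Qed.

Lemma uniform_dirichlet_poly A F : dirichlet_poly A F -> uniform_dirichlet A F.
Proof.
  intros H e He. exists F. split; [exact H|]. intros s _.
  replace (F s - F s)%C with (RtoC 0) by ring. rewrite Cmod_0. lra.
Qed.

Lemma uniform_dirichlet_limit A F :
  (forall e, 0 < e -> exists G, uniform_dirichlet A G /\ close_on_C0 F G e) ->
  uniform_dirichlet A F.
Proof.
  intros H e He. destruct (H (e / 2) ltac:(lra)) as [G [HG HFG]].
  destruct (HG (e / 2) ltac:(lra)) as [P [HP HGP]].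
  exists P. split; [exact HP|]. intros s Hs.
  pose proof (Cmod_triangle3 (F s) (G s) (P s)).
  specialize (HFG s Hs). specialize (HGP s Hs). lra.
Qed.

Lemma uniform_dirichlet_ext A F G :
  (forall s : C, 0 < Re s -> F s = G s) -> uniform_dirichlet A F -> uniform_dirichlet A G.
Proof.
  intros H HF e He. destruct (HF e He) as [P [HP HFP]]. exists P. split; [exact HP|].
  intros s Hs. rewrite <- H by exact Hs. now apply HFP.
Qed.

Lemma uniform_dirichlet_bounded A F :
  uniform_dirichlet A F -> exists B, 0 <= B /\ forall s : C, 0 < Re s -> Cmod (F s) <= B.
Proof.
  intros H. destruct (H 1 ltac:(lra)) as [P [HP HFP]].
  destruct (dirichlet_poly_bounded A P HP) as [B [HB HPB]].
  exists (B + 1). split; [lra|]. intros s Hs.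
  pose proof (Cmod_triangle_sub (F s) (P s)).
  specialize (HFP s Hs). specialize (HPB s Hs). lra.
Qed.

Lemma uniform_dirichlet_add A F G :
  uniform_dirichlet A F -> uniform_dirichlet A G -> uniform_dirichlet A (fun s => F s + G s)%C.
Proof.
  intros HF HG e He.
  destruct (HF (e / 2) ltac:(lra)) as [P [HP HFP]].
  destruct (HG (e / 2) ltac:(lra)) as [P' [HP' HGP]].
  exists (fun s => P s + P' s)%C. split; [now apply dirichlet_poly_add|].
  intros s Hs. replace (F s + G s - (P s + P' s))%C with ((F s - P s) + (G s - P' s))%C by ring.
  pose proof (Cmod_triangle (F s - P s)%C (G s - P' s)%C).
  specialize (HFP s Hs). specialize (HGP s Hs). lra.
Qed.

Lemma uniform_dirichlet_mult A F G :
  mult_subsemigroup A ->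
  uniform_dirichlet A F -> uniform_dirichlet A G -> uniform_dirichlet A (fun s => F s * G s)%C.
Proof.
  intros HA HF HG e He.
  destruct (uniform_dirichlet_bounded A F HF) as [B [HB HFB]].
  destruct (HG (e / (2 * (B + 1))) ltac:(apply Rdiv_lt_0_compat; lra)) as [P' [HP' HGP]].
  destruct (dirichlet_poly_bounded A P' HP') as [B' [HB' HPB]].
  destruct (HF (e / (2 * (B' + 1))) ltac:(apply Rdiv_lt_0_compat; lra)) as [P [HP HFP]].
  exists (fun s => P s * P' s)%C. split; [now apply dirichlet_poly_mult|].
  intros s Hs.
  replace (F s * G s - P s * P' s)%C with (F s * (G s - P' s) + (F s - P s) * P' s)%C by ring.
  eapply Rle_trans; [apply Cmod_triangle|]. rewrite !Cmod_mult.
  specialize (HFB s Hs). specialize (HGP s Hs). specialize (HPB s Hs). specialize (HFP s Hs).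
  assert (H1 : Cmod (F s) * Cmod (G s - P' s)%C <= (B + 1) * (e / (2 * (B + 1)))).
  { apply Rmult_le_compat; try apply Cmod_ge_0; lra. }
  assert (H2 : Cmod (F s - P s)%C * Cmod (P' s) <= (e / (2 * (B' + 1))) * (B' + 1)).
  { apply Rmult_le_compat; try apply Cmod_ge_0; lra. }
  replace ((B + 1) * (e / (2 * (B + 1)))) with (e / 2) in H1 by (field; lra).
  replace ((e / (2 * (B' + 1))) * (B' + 1)) with (e / 2) in H2 by (field; lra).
  lra.
Qed.

Lemma dirichlet_poly_const (A : nat -> Prop) c : A 1%nat -> dirichlet_poly A (fun _ => c).
Proof.
  intros H. apply (dirichlet_poly_ext _ (fun s => c * npow_neg 1 s)%C).
  - intros s. rewrite npow_neg_1. ring.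
  - apply dirichlet_poly_monomial; [lia|exact H].
Qed.

Lemma uniform_dirichlet_pow A F n :
  mult_subsemigroup A -> A 1%nat ->
  uniform_dirichlet A F -> uniform_dirichlet A (fun s => Cpow (F s) n).
Proof.
  intros HA H1 HF. induction n as [|n IH].
  - apply uniform_dirichlet_poly, (dirichlet_poly_const A (RtoC 1) H1).
  - apply (uniform_dirichlet_ext _ (fun s => F s * Cpow (F s) n)%C).
    + intros. now rewrite Cpow_S.
    + now apply uniform_dirichlet_mult.
Qed.

Lemma uniform_dirichlet_csum A (F : nat -> C -> C) n :
  (forall k, (k < n)%nat -> uniform_dirichlet A (F k)) ->
  uniform_dirichlet A (fun s => csum (fun k => F k s) n).
Proof.
  induction n as [|n IH]; intros H.
  - apply uniform_dirichlet_poly, dirichlet_poly_zero.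
  - cbn [csum]. apply uniform_dirichlet_add; [apply IH; intros|]; apply H; lia.
Qed.

(** * Coefficients of uniform limits and convergence of their series *)

(** A coefficient is a difference of two consecutive partial sums. At [s = 1 + 1],
    [partial_sum_shift_bound] with [sigma = 1] bounds each by [16 M], and the exponential undoes the
    factor [(k + 1)^-2]. The growth in [k] is harmless, as coefficients are compared one at a
    time. *)
Lemma coef_bound A a N M k :
  poly_coefs A a N -> (forall s : C, 0 < Re s -> Cmod (dsum a s N) <= M) ->
  Cmod (a (S k)) <= 32 * exp (2 * log_S k) * M.
Proof.
  intros Ha HM. pose proof (dirichlet_bound_nonneg a N M HM) as HM0.
  pose proof (exp_pos (2 * log_S k)) as He.
  assert (HN : forall s : C, 0 < Re s -> Cmod (dsum a s (N + S k)) <= M).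
  { intros s Hs. rewrite (dsum_stable A a N) by (assumption || lia). now apply HM. }
  assert (Hn : forall n, (n <= S k)%nat -> Cmod (dsum a (RtoC 1 + RtoC 1)%C n) <= 16 * M).
  { intros n Hn. replace (16 * M) with (2 * (4 + 4 / 1) * M) by field.
    apply (partial_sum_shift_bound a (N + S k) M 1 (RtoC 1) n HN); simpl; lra || lia. }
  assert (Heq : (a (S k) * npow_neg (S k) (RtoC 2))%C =
                (dsum a (RtoC 1 + RtoC 1)%C (S k) - dsum a (RtoC 1 + RtoC 1)%C k)%C).
  { replace (RtoC 1 + RtoC 1)%C with (RtoC 2).
    - unfold dsum. cbn [csum]. ring.
    - rewrite <- RtoC_plus. f_equal; ring. }
  assert (H : Cmod (a (S k) * npow_neg (S k) (RtoC 2))%C <= 32 * M).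
  { rewrite Heq. eapply Rle_trans; [apply Cmod_triangle|]. rewrite Cmod_opp.
    pose proof (Hn (S k) ltac:(lia)). pose proof (Hn k ltac:(lia)). lra. }
  rewrite Cmod_mult, Cmod_npow_neg, exp_Ropp in H. simpl Re in H. fold (log_S k) in H.
  replace (Cmod (a (S k)))
    with (exp (2 * log_S k) * (Cmod (a (S k)) * / exp (2 * log_S k))) by (field; lra).
  replace (32 * exp (2 * log_S k) * M) with (exp (2 * log_S k) * (32 * M)) by ring.
  apply Rmult_le_compat_l; lra.
Qed.

(** Here [b] is the limit of the coefficients of polynomials tending uniformly to [F]. Convergence
    of the series with coefficients [b] is not built in; it is the content of
    [has_coefs_converges]. *)
Definition has_coefs (A : nat -> Prop) (F : C -> C) (b : nat -> C) : Prop :=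
  forall e n, 0 < e -> exists a N, poly_coefs A a N /\
    close_on_C0 F (fun s => dsum a s N) e /\
    forall k, (k < n)%nat -> Cmod (b (S k) - a (S k))%C <= e.

Lemma coef_diff_bound A a N a' N' F e e' k :
  poly_coefs A a N -> poly_coefs A a' N' ->
  close_on_C0 F (fun s => dsum a s N) e -> close_on_C0 F (fun s => dsum a' s N') e' ->
  Cmod (a (S k) - a' (S k))%C <= 32 * exp (2 * log_S k) * (e + e').
Proof.
  intros Ha Ha' Hc Hc'.
  apply (coef_bound A (fun n => a n - a' n)%C (max N N') (e + e') k).
  - split.
    + intros n Hn HA. rewrite (proj1 Ha), (proj1 Ha') by assumption. ring.
    + intros n Hn. rewrite (proj2 Ha), (proj2 Ha') by lia. ring.
  - intros s Hs. rewrite dsum_sub.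
    rewrite (dsum_stable A a N), (dsum_stable A a' N') by (assumption || lia).
    pose proof (Cmod_triangle3 (dsum a s N) (F s) (dsum a' s N')) as H.
    specialize (Hc s Hs). specialize (Hc' s Hs). rewrite Cmod_sub_sym in Hc. lra.
Qed.

Lemma C_complete_seq (u : nat -> C) :
  (forall e, 0 < e -> exists N, forall i j, (N <= i)%nat -> (N <= j)%nat ->
     Cmod (u i - u j)%C <= e) ->
  exists l, forall e, 0 < e -> exists N, forall i, (N <= i)%nat -> Cmod (l - u i)%C <= e.
Proof.
  intros H.
  assert (Hp : forall p : C -> R, (forall x y, p (x - y)%C = p x - p y) ->
    (forall x, Rabs (p x) <= Cmod x) ->
    exists l : R, forall e, 0 < e -> exists N, forall i, (N <= i)%nat -> Rabs (l - p (u i)) <= e).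
  { intros p Hsub Hle. destruct (Rcomplete.R_complete (fun i => p (u i))) as [l Hl].
    - intros e He. destruct (H (e / 2) ltac:(lra)) as [N HN]. exists N.
      intros n m Hn Hm. unfold Rdist. rewrite <- Hsub.
      specialize (HN n m Hn Hm). specialize (Hle (u n - u m)%C). lra.
    - exists l. intros e He. destruct (Hl e He) as [N HN]. exists N. intros i Hi.
      specialize (HN i Hi). unfold Rdist in HN. rewrite Rabs_minus_sym. lra. }
  destruct (Hp Re) as [x Hx]; [reflexivity|apply Rabs_Re_Im_le|].
  destruct (Hp Im) as [y Hy]; [reflexivity|apply Rabs_Re_Im_le|].
  exists (x, y). intros e He.
  destruct (Hx (e / 2) ltac:(lra)) as [N1 H1]. destruct (Hy (e / 2) ltac:(lra)) as [N2 H2].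
  exists (max N1 N2). intros i Hi. specialize (H1 i ltac:(lia)). specialize (H2 i ltac:(lia)).
  eapply Rle_trans; [apply Cmod_le_Re_Im|].
  change (Rabs (x - Re (u i)) + Rabs (y - Im (u i)) <= e). lra.
Qed.

Lemma inv_INR_small e : 0 < e -> exists I, forall i, (I <= i)%nat -> / INR (S i) <= e.
Proof.
  intros He. destruct (le_INR_exists (/ e)) as [I HI]. exists I. intros i Hi.
  rewrite <- (Rinv_inv e). apply Rinv_le_contravar; [now apply Rinv_0_lt_compat|].
  rewrite S_INR. apply le_INR in Hi. lra.
Qed.

(** For approximants with errors [1 / (i + 1)], each coefficient forms a Cauchy sequence by
    [coef_diff_bound]. That bound grows with [k], so only finitely many coefficients are controlled
    at once, whence the clause [k < n] of [has_coefs]. *)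
Lemma uniform_dirichlet_coefs A F :
  uniform_dirichlet A F -> exists b, has_coefs A F b.
Proof.
  intros H.
  assert (Hch : forall i : nat, exists p : (nat -> C) * nat, poly_coefs A (fst p) (snd p) /\
     close_on_C0 F (fun s => dsum (fst p) s (snd p)) (/ INR (S i))).
  { intros i. destruct (H (/ INR (S i)) (Rinv_0_lt_compat _ (INR_S_pos i)))
      as [P [[a [N [Ha HP]]] HFP]].
    exists (a, N). split; [exact Ha|]. intros s Hs. simpl. rewrite <- HP. now apply HFP. }
  set (p := fun i => proj1_sig (constructive_indefinite_description _ (Hch i))).
  assert (Hp : forall i, poly_coefs A (fst (p i)) (snd (p i)) /\
     close_on_C0 F (fun s => dsum (fst (p i)) s (snd (p i))) (/ INR (S i))).
  { intros i. unfold p. apply (proj2_sig (constructive_indefinite_description _ (Hch i))). }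
  assert (Hlim : forall k, exists l, forall e, 0 < e ->
     exists N, forall i, (N <= i)%nat -> Cmod (l - fst (p i) (S k))%C <= e).
  { intros k. apply C_complete_seq. intros e He.
    set (K := 32 * exp (2 * log_S k)).
    assert (HK : 0 < K) by (unfold K; pose proof (exp_pos (2 * log_S k)); lra).
    destruct (inv_INR_small (e / (2 * K))) as [I HI]; [apply Rdiv_lt_0_compat; lra|].
    exists I. intros i j Hi Hj.
    eapply Rle_trans; [apply (coef_diff_bound A _ _ _ _ F _ _ k (proj1 (Hp i)) (proj1 (Hp j))
                               (proj2 (Hp i)) (proj2 (Hp j)))|].
    fold K. apply Rle_trans with (K * (e / (2 * K) + e / (2 * K))).
    - apply Rmult_le_compat_l; [lra|]. pose proof (HI i Hi). pose proof (HI j Hj). lra.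
    - right. field. lra. }
  set (b := fun n => match n with
                     | O => RtoC 0
                     | S k => proj1_sig (constructive_indefinite_description _ (Hlim k))
                     end).
  assert (Hb : forall k e, 0 < e ->
     exists N, forall i, (N <= i)%nat -> Cmod (b (S k) - fst (p i) (S k))%C <= e).
  { intros k. apply (proj2_sig (constructive_indefinite_description _ (Hlim k))). }
  exists b. intros e n He.
  destruct (inv_INR_small e He) as [I HI].
  assert (Hfin : exists I', forall i, (I' <= i)%nat -> forall k, (k < n)%nat ->
                  Cmod (b (S k) - fst (p i) (S k))%C <= e).
  { clearbody b. clear H. induction n as [|n [I1 IH]]; [exists O; intros; lia|].
    destruct (Hb n e He) as [I2 H2]. exists (max I1 I2). intros i Hi k Hk.
    destruct (Nat.eq_dec k n) as [->|]; [apply H2; lia|apply IH; lia]. }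
  destruct Hfin as [I' HI'].
  set (i := max I I').
  exists (fst (p i)), (snd (p i)). split; [apply Hp|]. split.
  - intros s Hs. eapply Rle_trans; [apply (proj2 (Hp i) s Hs)|]. apply HI. unfold i; lia.
  - apply HI'. unfold i; lia.
Qed.

Lemma has_coefs_supported A F b : has_coefs A F b -> supported A b.
Proof.
  intros H n Hn HA. destruct n as [|k]; [lia|].
  apply Cmod_eq_0, Rle_antisym; [|apply Cmod_ge_0].
  apply (le_of_forall_eps _ _ 1); [lra|]. intros e He.
  destruct (H e (S k) He) as [a [N [Ha [_ Hk]]]]. specialize (Hk k ltac:(lia)).
  rewrite (proj1 Ha) in Hk by assumption.
  replace (b (S k) - RtoC 0)%C with (b (S k)) in Hk by ring. lra.
Qed.

Lemma has_coefs_unique A F b b' k : has_coefs A F b -> has_coefs A F b' -> b (S k) = b' (S k).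
Proof.
  intros H H'.
  assert (H0 : (b (S k) - b' (S k))%C = RtoC 0).
  { apply Cmod_eq_0, Rle_antisym; [|apply Cmod_ge_0].
    set (K := 32 * exp (2 * log_S k)).
    assert (HK : 0 < K) by (unfold K; pose proof (exp_pos (2 * log_S k)); lra).
    apply (le_of_forall_eps _ _ (2 + 2 * K)); [lra|]. intros e He.
    destruct (H e (S k) He) as [a [N [Ha [Hc Hk]]]]. specialize (Hk k ltac:(lia)).
    destruct (H' e (S k) He) as [a' [N' [Ha' [Hc' Hk']]]]. specialize (Hk' k ltac:(lia)).
    pose proof (coef_diff_bound A a N a' N' F e e k Ha Ha' Hc Hc') as Hd. fold K in Hd.
    pose proof (Cmod_triangle3 (b (S k)) (a (S k)) (b' (S k))).
    pose proof (Cmod_triangle3 (a (S k)) (a' (S k)) (b' (S k))).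
    rewrite Cmod_sub_sym in Hk'. lra. }
  replace (b (S k)) with ((b (S k) - b' (S k)) + b' (S k))%C by ring. rewrite H0. ring.
Qed.

Lemma dsum_translate a s t n :
  dsum (fun n => a n * npow_neg n t)%C s n = dsum a (s + t)%C n.
Proof. apply csum_ext. intros k _. rewrite npow_neg_add. ring. Qed.

Lemma has_coefs_translate A F b t :
  0 <= t -> has_coefs A F b ->
  has_coefs A (fun s => F (s + RtoC t)%C) (fun n => b n * npow_neg n (RtoC t))%C.
Proof.
  intros Ht H e n He. destruct (H e n He) as [a [N [Ha [Hc Hk]]]].
  exists (fun n => a n * npow_neg n (RtoC t))%C, N. split; [split|split].
  - intros m Hm HA. rewrite (proj1 Ha) by assumption. ring.
  - intros m Hm. rewrite (proj2 Ha) by assumption. ring.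
  - intros s Hs. simpl. rewrite dsum_translate. apply Hc. simpl. unfold Re in Hs. lra.
  - intros k Hkn.
    replace (b (S k) * npow_neg (S k) (RtoC t) - a (S k) * npow_neg (S k) (RtoC t))%C
      with ((b (S k) - a (S k)) * npow_neg (S k) (RtoC t))%C by ring.
    rewrite Cmod_mult, <- (Rmult_1_r e).
    apply Rmult_le_compat; try apply Cmod_ge_0; [now apply Hk|].
    apply Cmod_npow_neg_le_1. exact Ht.
Qed.

(** For an approximant [a] within [eta] of [F] and another one [a'], the polynomial [a' - a] is
    small on the whole half-plane, so [partial_sum_shift_bound], started from [s - Re s / 2], bounds
    its partial sums at [s] uniformly in their length. Letting [a'] tend to [b] compares [b] with
    [a], whose partial sums are complete from [N] on. *)
Lemma has_coefs_converges A F b (s : C) :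
  has_coefs A F b -> 0 < Re s ->
  forall e, 0 < e -> exists N, forall n, (N <= n)%nat -> Cmod (dsum b s n - F s)%C <= e.
Proof.
  intros H Hs e He.
  set (K := 2 * (4 + 4 / (Re s / 2))).
  assert (HK : 0 < K) by (unfold K; pose proof (Rdiv_lt_0_compat 4 (Re s / 2)); lra).
  set (eta := e / (K + 1)).
  assert (Heta : 0 < eta) by (apply Rdiv_lt_0_compat; lra).
  destruct (H eta O Heta) as [a [N [Ha [Hc _]]]].
  exists N. intros n Hn.
  replace e with (K * eta + eta) by (unfold eta; field; lra).
  pose proof (Cmod_triangle3 (dsum b s n) (dsum a s N) (F s)) as Ht.
  pose proof (Hc s Hs) as Hcs. simpl in Hcs. rewrite Cmod_sub_sym in Hcs.
  assert (Cmod (dsum b s n - dsum a s N)%C <= K * eta); [|lra].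
  rewrite <- (dsum_stable A a N n s Ha Hn).
  apply (le_of_forall_eps _ _ (INR n + K)); [pose proof (pos_INR n); lra|].
  intros e' He'. destruct (H e' n He') as [a' [N' [Ha' [Hc' Hk']]]].
  pose proof (Cmod_triangle3 (dsum b s n) (dsum a' s n) (dsum a s n)) as Ht'.
  assert (H1 : Cmod (dsum b s n - dsum a' s n)%C <= INR n * e').
  { rewrite <- dsum_sub. unfold dsum.
    replace (INR n * e') with (rsum (fun _ => e') n).
    - apply Cmod_csum_le. intros k Hk. rewrite Cmod_mult, <- (Rmult_1_r e').
      apply Rmult_le_compat; try apply Cmod_ge_0; [now apply Hk'|].
      apply Cmod_npow_neg_le_1. lra.
    - clear. induction n as [|n IH]; [simpl; ring|]. rewrite S_INR. cbn [rsum]. rewrite IH. ring. }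
  assert (H2 : Cmod (dsum a' s n - dsum a s n)%C <= K * (eta + e')).
  { rewrite <- dsum_sub. set (s' := (s - RtoC (Re s / 2))%C).
    replace s with (s' + RtoC (Re s / 2))%C at 1 by (unfold s'; ring).
    apply (partial_sum_shift_bound _ (n + N + N')); [|lra| |lia].
    - intros z Hz. rewrite dsum_sub.
      rewrite (dsum_stable A a N), (dsum_stable A a' N') by (assumption || lia).
      pose proof (Cmod_triangle3 (dsum a' z N') (F z) (dsum a z N)) as Hzz.
      pose proof (Hc z Hz). pose proof (Hc' z Hz) as Hz'. simpl in *.
      rewrite Cmod_sub_sym in Hz'. lra.
    - unfold s'. simpl. unfold Re in *. lra. }
  lra.
Qed.

(** * Taylor expansion of exponential sums *)

(* Averages over [L]-th roots of unity replace the Cauchy integral: they are exact on the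
   Taylor polynomial of degree [L - 1]. *)
Lemma cauchy_coef_bound (p : C -> C) (c : nat -> C) (r B : R) k :
  0 <= r ->
  (forall e, 0 < e -> exists L0, forall L, (L0 <= L)%nat -> forall w, Cmod w <= r ->
     Cmod (p w - csum (fun k => c k * Cpow w k) L)%C <= e) ->
  (forall w, Cmod w = r -> Cmod (p w) <= B) ->
  Cmod (c k) * r ^ k <= B.
Proof.
  intros Hr Hu HB. apply (le_of_forall_eps _ _ 1); [lra|]. intros e He.
  destruct (Hu e He) as [L0 HL0].
  set (L := max L0 (S k)).
  assert (HL : 0 < INR L) by (apply (lt_INR 0); unfold L; lia).
  set (w := fun j => (RtoC r * cis (INR j * (2 * PI / INR L)))%C).
  assert (Hw : forall j, Cmod (w j) = r).
  { intros j. unfold w. rewrite Cmod_mult, Cmod_cis, Cmod_RtoC_nonneg by lra. ring. }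
  (* Discrete Fourier inversion on the circle of radius [r]: the frequencies [l - k] are below [L]
     in absolute value, so only [l = k] survives. *)
  assert (Heq : csum (fun j => cis (- (INR k * (INR j * (2 * PI / INR L)))) *
                   csum (fun l => c l * Cpow (w j) l) L)%C L =
                (RtoC (INR L) * (c k * RtoC (r ^ k)))%C).
  { rewrite (csum_ext _ (fun j => csum (fun l => (c l * RtoC (r ^ l)) *
       cis (INR j * (2 * PI * IZR (Z.of_nat l - Z.of_nat k) / INR L)))%C L)).
    - rewrite csum_swap, (csum_single _ L k).
      + rewrite csum_scal, (csum_ext _ (fun _ => RtoC 1)), csum_const; [ring|].
        intros j _. rewrite Z.sub_diag.
        replace (INR j * (2 * PI * 0 / INR L)) with 0 by (field; lra). apply cis_0.
      + unfold L; lia.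
      + intros l Hl Hlk. rewrite csum_scal, roots_of_unity_sum by lia. ring.
    - intros j _. rewrite <- csum_scal. apply csum_ext. intros l _.
      unfold w. rewrite Cpow_mult_l, <- cis_INR_mult, <- RtoC_pow.
      replace (cis (INR j * (2 * PI * IZR (Z.of_nat l - Z.of_nat k) / INR L)))
        with (cis (- (INR k * (INR j * (2 * PI / INR L)))) *
              cis (INR l * (INR j * (2 * PI / INR L))))%C; [ring|].
      rewrite <- cis_add. f_equal. rewrite minus_IZR, <- !INR_IZR_INZ. field. lra. }
  apply (f_equal Cmod) in Heq.
  rewrite !Cmod_mult, !Cmod_RtoC_nonneg in Heq by (apply pow_le || idtac; lra).
  apply (Rmult_le_reg_l (INR L)); [exact HL|]. rewrite <- Heq.
  replace (INR L * (B + 1 * e)) with (rsum (fun _ => B + e) L).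
  - apply Cmod_csum_le. intros j _. rewrite Cmod_mult, Cmod_cis, Rmult_1_l.
    specialize (HL0 L ltac:(unfold L; lia) (w j) ltac:(rewrite Hw; lra)).
    specialize (HB (w j) (Hw j)). rewrite Cmod_sub_sym in HL0.
    pose proof (Cmod_triangle_sub (csum (fun l => c l * Cpow (w j) l)%C L) (p (w j))).
    lra.
  - clear. induction L as [|n IH]; [simpl; ring|]. rewrite S_INR. cbn [rsum]. rewrite IH. ring.
Qed.

Lemma rsum_geometric_le rho n : 0 <= rho < 1 -> rsum (fun i => rho ^ i) n <= / (1 - rho).
Proof.
  intros H.
  assert (Heq : rsum (fun i => rho ^ i) n * (1 - rho) = 1 - rho ^ n).
  { induction n as [|n IH]; [simpl; ring|]. cbn [rsum]. rewrite Rmult_plus_distr_r, IH.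
    simpl. ring. }
  apply (Rmult_le_reg_r (1 - rho)); [lra|]. rewrite Heq, Rinv_l by lra.
  pose proof (pow_le rho n ltac:(lra)). lra.
Qed.

(** The Cauchy estimates at radius [r] make the tail geometric for [|w| <= rho r]. The bound
    involves [B] but not the coefficients, which is what makes it uniform in the applications. *)
Lemma cauchy_remainder (p : C -> C) (c : nat -> C) (r B rho : R) (w : C) K :
  0 <= r -> 0 <= rho < 1 ->
  (forall e, 0 < e -> exists L0, forall L, (L0 <= L)%nat -> forall w, Cmod w <= r ->
     Cmod (p w - csum (fun k => c k * Cpow w k) L)%C <= e) ->
  (forall w, Cmod w = r -> Cmod (p w) <= B) ->
  Cmod w <= rho * r ->
  Cmod (p w - csum (fun k => c k * Cpow w k) K)%C <= B * rho ^ K / (1 - rho).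
Proof.
  intros Hr Hrho Hu HB Hw. apply (le_of_forall_eps _ _ 1); [lra|]. intros e He.
  assert (HB0 : 0 <= B).
  { eapply Rle_trans; [apply Cmod_ge_0|]. apply (HB (RtoC r)). now apply Cmod_RtoC_nonneg. }
  destruct (Hu e He) as [L0 HL0].
  specialize (HL0 (K + L0)%nat ltac:(lia) w ltac:(nra)).
  rewrite csum_split in HL0.
  set (T := csum (fun k => c (K + k)%nat * Cpow w (K + k))%C L0) in *.
  set (S0 := csum (fun k => c k * Cpow w k)%C K) in *.
  pose proof (Cmod_triangle (p w - (S0 + T))%C T) as Ht.
  replace (p w - (S0 + T) + T)%C with (p w - S0)%C in Ht by ring.
  assert (HT : Cmod T <= B * rho ^ K / (1 - rho)); [|lra].
  apply Rle_trans with (rsum (fun i => (B * rho ^ K) * rho ^ i) L0).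
  - apply Cmod_csum_le. intros i _. rewrite Cmod_mult, Cmod_pow.
    apply Rle_trans with (Cmod (c (K + i)%nat) * (rho * r) ^ (K + i)).
    + apply Rmult_le_compat_l; [apply Cmod_ge_0|]. apply pow_incr.
      split; [apply Cmod_ge_0|exact Hw].
    + rewrite Rpow_mult_distr, Rmult_assoc, <- pow_add.
      pose proof (cauchy_coef_bound p c r B (K + i) Hr Hu HB) as Hc.
      pose proof (pow_le rho (K + i) ltac:(lra)). nra.
  - rewrite rsum_scal. unfold Rdiv. apply Rmult_le_compat_l.
    + pose proof (pow_le rho K ltac:(lra)). nra.
    + now apply rsum_geometric_le.
Qed.

(** * Taylor remainder of the complex exponential *)

Definition exp_taylor (K : nat) (z : C) : C :=
  csum (fun k => RtoC (/ INR (fact k)) * Cpow z k)%C K.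

Lemma is_derive_divided_power L (t : R) :
  is_derive (fun t : R => t ^ S L / INR (fact (S L))) t (t ^ L / INR (fact L)).
Proof.
  assert (Hf := INR_fact_neq_0 L). pose proof (INR_S_pos L).
  apply (is_derive_ext (fun t : R => / INR (fact (S L)) * t ^ S L)).
  { intros x. apply Rmult_comm. }
  replace (t ^ L / INR (fact L)) with (/ INR (fact (S L)) * (INR (S L) * 1 * t ^ pred (S L))).
  - apply is_derive_scal. apply (is_derive_pow (fun x => x) (S L) t 1).
    apply (is_derive_id t).
  - rewrite fact_simpl, mult_INR. simpl pred. field. split; lra.
Qed.

(** With [v] the claimed bound, [v - u] and [v + u] vanish at [0] and have nonnegative derivative on
    [[0, 1]]; the mean value theorem thus stands in for integration. *)
Lemma integrate_monomial_bound (u u' : R -> R) c L t :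
  (forall t, is_derive u t (u' t)) -> u 0 = 0 ->
  (forall t, 0 <= t <= 1 -> Rabs (u' t) <= c * (t ^ L / INR (fact L))) ->
  0 <= t <= 1 -> Rabs (u t) <= c * (t ^ S L / INR (fact (S L))).
Proof.
  intros Hd H0 Hb Ht.
  set (v := fun t => c * (t ^ S L / INR (fact (S L)))).
  assert (Hf := INR_fact_neq_0 L).
  assert (Hv : forall t, is_derive v t (c * (t ^ L / INR (fact L)))).
  { intros x. apply (is_derive_scal (fun t : R => t ^ S L / INR (fact (S L)))).
    apply is_derive_divided_power. }
  assert (Hv0 : v 0 = 0) by (unfold v; simpl; unfold Rdiv; ring).
  assert (Hmono : forall g g' : R -> R, (forall t, is_derive g t (g' t)) -> g 0 = 0 ->
     (forall t, 0 <= t <= 1 -> 0 <= g' t) -> 0 <= g t).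
  { intros g g' Hg Hg0 Hpos.
    destruct (MVT_gen g 0 t g') as [x [Hx Heq]].
    - intros x _. apply Hg.
    - intros x _. apply continuity_pt_filterlim.
      apply (ex_derive_continuous g x). eexists; apply Hg.
    - rewrite Rmin_left, Rmax_right in Hx by lra.
      specialize (Hpos x ltac:(lra)). rewrite Hg0 in Heq. nra. }
  fold (v t). apply Rabs_le.
  assert (H1 : 0 <= v t - u t).
  { apply (Hmono (fun t => v t - u t) (fun t => c * (t ^ L / INR (fact L)) - u' t)).
    - intros x. apply (is_derive_minus v u x); auto.
    - lra.
    - intros x Hx. specialize (Hb x Hx). apply Rabs_le_between in Hb. lra. }
  assert (H2 : 0 <= v t + u t).
  { apply (Hmono (fun t => v t + u t) (fun t => c * (t ^ L / INR (fact L)) + u' t)).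
    - intros x. apply (is_derive_plus v u x); auto.
    - lra.
    - intros x Hx. specialize (Hb x Hx). apply Rabs_le_between in Hb. lra. }
  lra.
Qed.

Definition is_Cderive (F : R -> C) (t : R) (l : C) : Prop :=
  is_derive (fun t => Re (F t)) t (Re l) /\ is_derive (fun t => Im (F t)) t (Im l).

Lemma is_Cderive_ext F G t l : (forall t, F t = G t) -> is_Cderive F t l -> is_Cderive G t l.
Proof.
  intros H [H1 H2]. split.
  - apply (is_derive_ext (fun t => Re (F t))); [|exact H1]. intros; now rewrite H.
  - apply (is_derive_ext (fun t => Im (F t))); [|exact H2]. intros; now rewrite H.
Qed.

Lemma is_Cderive_plus F G t l m :
  is_Cderive F t l -> is_Cderive G t m -> is_Cderive (fun t => F t + G t)%C t (l + m)%C.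
Proof.
  intros [H1 H2] [H3 H4]. split.
  - apply (is_derive_plus (fun t => Re (F t)) (fun t => Re (G t))); assumption.
  - apply (is_derive_plus (fun t => Im (F t)) (fun t => Im (G t))); assumption.
Qed.

Lemma is_Cderive_minus F G t l m :
  is_Cderive F t l -> is_Cderive G t m -> is_Cderive (fun t => F t - G t)%C t (l - m)%C.
Proof.
  intros [H1 H2] [H3 H4]. split.
  - apply (is_derive_minus (fun t => Re (F t)) (fun t => Re (G t))); assumption.
  - apply (is_derive_minus (fun t => Im (F t)) (fun t => Im (G t))); assumption.
Qed.

Lemma is_Cderive_scal (g : R -> R) t l c :
  is_derive g t l -> is_Cderive (fun t => RtoC (g t) * c)%C t (RtoC l * c)%C.
Proof.
  intros H. split.
  - apply (is_derive_ext (fun t => Re c * g t)); [intros; simpl; unfold Re; ring|].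
    replace (Re (RtoC l * c)%C) with (Re c * l) by (simpl; unfold Re; ring).
    now apply (is_derive_scal g t (Re c)).
  - apply (is_derive_ext (fun t => Im c * g t)); [intros; simpl; unfold Im; ring|].
    replace (Im (RtoC l * c)%C) with (Im c * l) by (simpl; unfold Im; ring).
    now apply (is_derive_scal g t (Im c)).
Qed.

Lemma is_Cderive_Cexp z t : is_Cderive (fun t => Cexp (RtoC t * z)%C) t (z * Cexp (RtoC t * z))%C.
Proof.
  destruct z as [x y]. unfold Cexp. split; simpl; auto_derive; trivial;
    unfold Rminus; ring.
Qed.

Definition exp_remainder (z : C) (L : nat) (t : R) : C :=
  (Cexp (RtoC t * z) - csum (fun k => RtoC (t ^ k / INR (fact k)) * Cpow z k) L)%C.

Lemma exp_remainder_derive z L t :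
  is_Cderive (exp_remainder z (S L)) t (z * exp_remainder z L t)%C.
Proof.
  unfold exp_remainder. rewrite Cmult_sub_distr_l.
  apply is_Cderive_minus; [apply is_Cderive_Cexp|].
  induction L as [|L IH].
  - apply (is_Cderive_ext (fun _ => RtoC 1 * RtoC 1)%C).
    { intros x. cbn [csum]. replace (x ^ 0 / INR (fact 0)) with 1 by (simpl; field).
      cbn [Cpow]. ring. }
    replace (z * csum _ 0)%C with (RtoC 0 * RtoC 1)%C by (cbn [csum]; ring).
    apply (is_Cderive_scal (fun _ => 1)). apply (is_derive_const (1 : R)).
  - apply (is_Cderive_ext (fun t => (csum (fun k => RtoC (t ^ k / INR (fact k)) * Cpow z k) (S L)
        + RtoC (t ^ S L / INR (fact (S L))) * Cpow z (S L))%C)); [reflexivity|].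
    cbn [csum] in IH |- *. rewrite Cmult_plus_distr_l.
    apply is_Cderive_plus; [exact IH|].
    replace (z * (RtoC (t ^ L / INR (fact L)) * Cpow z L))%C
      with (RtoC (t ^ L / INR (fact L)) * Cpow z (S L))%C by (rewrite Cpow_S; ring).
    apply is_Cderive_scal. apply is_derive_divided_power.
Qed.

Lemma exp_remainder_at_0 z L : exp_remainder z (S L) 0 = RtoC 0.
Proof.
  unfold exp_remainder. rewrite csum_shift, (csum_ext _ (fun _ => RtoC 0)), csum_zero.
  - rewrite Cmult_0_l. unfold Cexp, RtoC; simpl. rewrite exp_0, cos_0, sin_0.
    apply injective_projections; simpl; field.
  - intros k _. rewrite pow_i by lia. unfold Rdiv. rewrite Rmult_0_l. ring.
Qed.

(** Each order applies [integrate_monomial_bound] to [exp_remainder_derive]. Real and imaginary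
    parts are bounded separately, whence a factor [2] per order, which the factorial absorbs. *)
Lemma exp_remainder_bound z X L t :
  Cmod z <= X -> 0 <= t <= 1 ->
  Cmod (exp_remainder z L t) <= (exp X * (2 * X) ^ L) * (t ^ L / INR (fact L)).
Proof.
  intros HX. revert t. pose proof (Cmod_ge_0 z) as Hz0.
  induction L as [|L IH]; intros t Ht.
  - unfold exp_remainder. simpl.
    replace (Cexp (RtoC t * z) - RtoC 0)%C with (Cexp (RtoC t * z)) by ring.
    rewrite Cmod_Cexp. replace (exp X * 1 * (1 / 1)) with (exp X) by field.
    apply exp_mono. destruct (Rabs_Re_Im_le (RtoC t * z)%C) as [H _].
    rewrite Cmod_mult, Cmod_RtoC_nonneg in H by lra.
    pose proof (Rle_abs (Re (RtoC t * z)%C)). nra.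
  - assert (Hf : 0 < INR (fact L)) by apply INR_fact_lt_0.
    assert (Hd : forall t, 0 <= t <= 1 -> Cmod (z * exp_remainder z L t)%C <=
              (exp X * (2 * X) ^ L * X) * (t ^ L / INR (fact L))).
    { intros x Hx. rewrite Cmod_mult. specialize (IH x Hx).
      replace (exp X * (2 * X) ^ L * X * (x ^ L / INR (fact L)))
        with (X * (exp X * (2 * X) ^ L * (x ^ L / INR (fact L)))) by ring.
      apply Rmult_le_compat; try apply Cmod_ge_0; lra. }
    eapply Rle_trans; [apply Cmod_le_Re_Im|].
    replace (exp X * (2 * X) ^ S L * (t ^ S L / INR (fact (S L))))
      with ((exp X * (2 * X) ^ L * X) * (t ^ S L / INR (fact (S L))) +
            (exp X * (2 * X) ^ L * X) * (t ^ S L / INR (fact (S L)))) by (simpl pow; ring).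
    apply Rplus_le_compat.
    + apply (integrate_monomial_bound (fun t => Re (exp_remainder z (S L) t))
               (fun t => Re (z * exp_remainder z L t)%C)); auto.
      * intros x. apply exp_remainder_derive.
      * rewrite exp_remainder_at_0. reflexivity.
      * intros x Hx. eapply Rle_trans; [apply Rabs_Re_Im_le|]. now apply Hd.
    + apply (integrate_monomial_bound (fun t => Im (exp_remainder z (S L) t))
               (fun t => Im (z * exp_remainder z L t)%C)); auto.
      * intros x. apply exp_remainder_derive.
      * rewrite exp_remainder_at_0. reflexivity.
      * intros x Hx. eapply Rle_trans; [apply Rabs_Re_Im_le|]. now apply Hd.
Qed.

Lemma exp_taylor_uniform X e :
  0 < e -> exists L0, forall L, (L0 <= L)%nat -> forall z, Cmod z <= X ->
  Cmod (Cexp z - exp_taylor L z)%C <= e.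
Proof.
  intros He. pose proof (exp_pos X) as HX.
  destruct (cv_speed_pow_fact (2 * X) (e / exp X)) as [L0 HL0].
  { apply Rdiv_lt_0_compat; lra. }
  exists L0. intros L HL z Hz. specialize (HL0 L HL). unfold Rdist in HL0.
  rewrite Rminus_0_r in HL0. pose proof (Rle_abs ((2 * X) ^ L / INR (fact L))) as Habs.
  pose proof (exp_remainder_bound z X L 1 Hz ltac:(lra)) as H.
  replace (exp_remainder z L 1) with (Cexp z - exp_taylor L z)%C in H.
  - rewrite pow1 in H. eapply Rle_trans; [exact H|].
    replace (exp X * (2 * X) ^ L * (1 / INR (fact L)))
      with (exp X * ((2 * X) ^ L / INR (fact L))) by (unfold Rdiv; ring).
    replace e with (exp X * (e / exp X)) by (field; lra).
    apply Rmult_le_compat_l; lra.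
  - unfold exp_remainder, exp_taylor. rewrite Cmult_1_l.
    apply (f_equal (fun x => Cexp z - x)%C). apply csum_ext. intros k _. rewrite pow1. unfold Rdiv. now rewrite Rmult_1_l.
Qed.

(** A finite Dirichlet sum is entire, so its expansion at [0] converges uniformly on the disc, by
    induction on the number of terms. [cauchy_remainder] then gives a remainder in which [N] does
    not occur, as the passage to infinite series demands. *)
Lemma dsum_taylor (a : nat -> C) (N : nat) (r B rho : R) (w : C) K :
  0 <= r -> 0 <= rho < 1 ->
  (forall w, Cmod w = r -> Cmod (dsum a w N) <= B) ->
  Cmod w <= rho * r ->
  Cmod (dsum a w N - csum (fun n => a (S n) * exp_taylor K (- w * RtoC (log_S n))) N)%C
  <= B * rho ^ K / (1 - rho).
Proof.
  intros Hr Hrho HB Hw.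
  set (c := fun k => csum (fun n => a (S n) *
              (RtoC (/ INR (fact k)) * Cpow (- RtoC (log_S n)) k))%C N).
  assert (Hc : forall w L, csum (fun k => c k * Cpow w k)%C L =
     csum (fun n => a (S n) * exp_taylor L (- w * RtoC (log_S n)))%C N).
  { intros w' L. unfold c, exp_taylor.
    rewrite (csum_ext _ (fun k => csum (fun n => a (S n) *
        (RtoC (/ INR (fact k)) * Cpow (- w' * RtoC (log_S n)) k))%C N)).
    - rewrite csum_swap. apply csum_ext. intros n _. apply csum_scal.
    - intros k _. rewrite <- csum_scal_r. apply csum_ext. intros n _.
      replace (- w' * RtoC (log_S n))%C with (- RtoC (log_S n) * w')%C by ring.
      rewrite Cpow_mult_l. ring. }
  rewrite <- Hc. apply (cauchy_remainder (fun w => dsum a w N) c r B rho w K); auto.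
  clear HB Hw w K. intros e He.
  assert (H : forall e, 0 < e -> exists L0, forall L, (L0 <= L)%nat -> forall w, Cmod w <= r ->
     Cmod (dsum a w N - csum (fun n => a (S n) * exp_taylor L (- w * RtoC (log_S n))) N)%C <= e).
  2:{ destruct (H e He) as [L0 HL0]. exists L0. intros L HL w Hw. rewrite Hc. now apply HL0. }
  clear Hc c. clear e He. unfold dsum.
  induction N as [|N IH]; intros e He.
  - exists O. intros L _ w _. simpl. replace (RtoC 0 - RtoC 0)%C with (RtoC 0) by ring.
    rewrite Cmod_0. lra.
  - destruct (IH (e / 2) ltac:(lra)) as [L1 H1].
    pose proof (Cmod_ge_0 (a (S N))) as Ha. pose proof (log_S_nonneg N) as Hl.
    destruct (exp_taylor_uniform (r * log_S N) (e / 2 / (Cmod (a (S N)) + 1))) as [L2 H2].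
    { apply Rdiv_lt_0_compat; lra. }
    exists (max L1 L2). intros L HL w Hw.
    specialize (H1 L ltac:(lia) w Hw). specialize (H2 L ltac:(lia) (- w * RtoC (log_S N))%C).
    rewrite Cmod_mult, Cmod_opp, Cmod_RtoC_nonneg in H2 by exact Hl.
    specialize (H2 (Rmult_le_compat_r _ _ _ Hl Hw)).
    cbn [csum].
    match goal with |- Cmod ((?x + ?y) - (?x' + ?y'))%C <= _ =>
      replace ((x + y) - (x' + y'))%C with ((x - x') + (y - y'))%C by ring end.
    eapply Rle_trans; [apply Cmod_triangle|].
    rewrite <- Cmult_sub_distr_l, Cmod_mult.
    change (npow_neg (S N) w) with (Cexp (- w * RtoC (log_S N))%C).
    set (d := Cmod (Cexp _ - _)%C) in *.
    assert (Cmod (a (S N)) * d <= (Cmod (a (S N)) + 1) * (e / 2 / (Cmod (a (S N)) + 1))).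
    { apply Rmult_le_compat; try lra. apply Cmod_ge_0. }
    replace ((Cmod (a (S N)) + 1) * (e / 2 / (Cmod (a (S N)) + 1))) with (e / 2) in H
      by (field; lra).
    lra.
Qed.

(** * Translates of bounded Dirichlet series *)

Lemma sin_sqr_le x : Rsqr (sin x) <= Rsqr x.
Proof.
  assert (H : forall y, 0 <= y -> Rsqr (sin y) <= Rsqr y).
  { intros y Hy. destruct (Rle_lt_dec 1 y) as [H1|H1].
    - pose proof (SIN_bound y). unfold Rsqr. nra.
    - destruct (Req_dec y 0) as [->|Hne]; [rewrite sin_0; lra|].
      pose proof (sin_lt_x y ltac:(lra)). pose proof PI2_1.
      pose proof (sin_ge_0 y ltac:(lra) ltac:(lra)). unfold Rsqr. nra. }
  destruct (Rle_lt_dec 0 x) as [Hx|Hx]; [now apply H|].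
  rewrite (Rsqr_neg (sin x)), (Rsqr_neg x), <- sin_neg. apply H. lra.
Qed.

Lemma Cmod_cis_sub_1_le v : Cmod (cis v - 1)%C <= Rabs v.
Proof.
  apply Rsqr_incr_0; [|apply Cmod_ge_0|apply Rabs_pos].
  rewrite <- Rsqr_abs, Rsqr_pow2, Cmod_cis_sub_1.
  pose proof (cos_2a_sin (v / 2)) as H. replace (2 * (v / 2)) with v in H by field.
  pose proof (sin_sqr_le (v / 2)) as Hs. unfold Rsqr in *. lra.
Qed.

(** The variation of [n^-w] is compared with that of the real power [n^-(Re w)], which telescopes.
    The angular part is at most [E |y| d], and [E x d <= 1 - E] because [exp (x d) >= 1 + x d]. *)
Lemma npow_neg_variation (w : C) k : 0 < Re w ->
  Cmod (npow_neg (S k) w - npow_neg (S (S k)) w)%C <=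
  (1 + Rabs (Im w) / Re w) * (exp (- (Re w * log_S k)) - exp (- (Re w * log_S (S k)))).
Proof.
  intros Hw. pose proof (log_S_le k (S k) ltac:(lia)) as Hl.
  set (d := log_S (S k) - log_S k). set (x := Re w) in *. set (y := Im w).
  set (E := exp (- (x * d))).
  assert (HE : 0 < E) by apply exp_pos.
  assert (HE1 : E * (1 + x * d) <= 1).
  { replace 1 with (E * exp (x * d)) at 2.
    - apply Rmult_le_compat_l; [lra|apply exp_ineq1_le].
    - unfold E. rewrite <- exp_plus, Rplus_opp_l. apply exp_0. }
  assert (Heq1 : exp (- (x * log_S (S k))) = exp (- (x * log_S k)) * E).
  { unfold E. rewrite <- exp_plus. f_equal. unfold d. ring. }
  assert (Heq : (npow_neg (S k) w - npow_neg (S (S k)) w)%C =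
    (npow_neg (S k) w * (RtoC (1 - E) - RtoC E * (cis (- (y * d)) - 1)))%C).
  { rewrite !npow_neg_polar. fold x y. fold (log_S k) (log_S (S k)).
    rewrite Heq1.
    replace (cis (- (y * log_S (S k)))) with (cis (- (y * log_S k)) * cis (- (y * d)))%C.
    - rewrite RtoC_mult, RtoC_minus. ring.
    - rewrite <- cis_add. f_equal. unfold d. ring. }
  rewrite Heq, Cmod_mult, Cmod_npow_neg. fold x. fold (log_S k).
  rewrite Heq1.
  replace ((1 + Rabs y / x) * (exp (- (x * log_S k)) - exp (- (x * log_S k)) * E))
    with (exp (- (x * log_S k)) * ((1 - E) + Rabs y / x * (1 - E))) by ring.
  apply Rmult_le_compat_l; [apply Rlt_le, exp_pos|].
  assert (Hd : 0 <= d) by (unfold d; lra).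
  assert (Hxd : 0 <= E * (x * d)) by (apply Rmult_le_pos; nra).
  eapply Rle_trans; [apply Cmod_triangle|]. rewrite Cmod_opp, Cmod_mult.
  rewrite !Cmod_RtoC_nonneg by nra.
  apply Rplus_le_compat_l.
  apply Rle_trans with (E * Rabs (- (y * d))).
  - apply Rmult_le_compat_l; [lra|]. apply Cmod_cis_sub_1_le.
  - rewrite Rabs_Ropp, Rabs_mult, (Rabs_pos_eq d) by lra.
    replace (E * (Rabs y * d)) with (Rabs y / x * (E * (x * d))) by (field; lra).
    apply Rmult_le_compat_l; [|lra].
    apply Rdiv_le_0_compat; [apply Rabs_pos|exact Hw].
Qed.

(** Abel summation transports convergence from the real point [sigma0]. With [w = z - sigma0], the
    bounds on [Re z] and [Im z] keep the variation factor [1 + |Im w| / Re w] below the constant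
    [kap]. *)
Lemma dsum_uniform_cauchy (a : nat -> C) (sigma0 delta Y : R) :
  (forall e, 0 < e -> exists N, forall m n, (N <= m)%nat -> (N <= n)%nat ->
     Cmod (dsum a (RtoC sigma0) m - dsum a (RtoC sigma0) n)%C <= e) ->
  0 < delta -> 0 <= Y ->
  forall e, 0 < e -> exists N, forall m n, (N <= m)%nat -> (m <= n)%nat ->
    forall z : C, sigma0 + delta <= Re z -> Rabs (Im z) <= Y ->
    Cmod (dsum a z n - dsum a z m)%C <= e.
Proof.
  intros Hc Hd HY e He.
  set (kap := 1 + Y / delta).
  assert (Hkap : 1 <= kap) by (unfold kap; pose proof (Rdiv_le_0_compat Y delta); lra).
  (* [kap] pays for the telescoping sum and [1] for the boundary term. *)
  destruct (Hc (e / (kap + 1))) as [N HN]; [apply Rdiv_lt_0_compat; lra|].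
  set (h := e / (kap + 1)) in *.
  assert (Hh : 0 < h) by (apply Rdiv_lt_0_compat; lra).
  exists N. intros m n Hm Hmn z Hz HzY.
  replace n with (m + (n - m))%nat by lia. set (l := (n - m)%nat).
  set (u := fun k => (a (S (m + k)) * npow_neg (S (m + k)) (RtoC sigma0))%C).
  set (w := (z - RtoC sigma0)%C).
  assert (Hw : delta <= Re w) by (unfold w; simpl; unfold Re in Hz; lra).
  assert (Hwi : Im w = Im z) by (unfold w; simpl; unfold Im; ring).
  set (v := fun k => npow_neg (S (m + k)) w).
  assert (Hu : forall j, Cmod (csum u j) <= h).
  { intros j. specialize (HN (m + j)%nat m ltac:(lia) Hm). unfold dsum in HN.
    rewrite csum_split in HN. fold u in HN.
    match goal with H : Cmod ?x <= h |- _ => replace x with (csum u j) in H by ring end.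
    exact HN. }
  assert (Heq : (dsum a z (m + l) - dsum a z m)%C = csum (fun k => u k * v k)%C l).
  { unfold dsum. rewrite csum_split.
    match goal with |- (?x + ?y - ?x)%C = _ => replace (x + y - x)%C with y by ring end.
    apply csum_ext. intros k _. unfold u, v.
    replace z with (RtoC sigma0 + w)%C at 1 by (unfold w; ring).
    rewrite npow_neg_add. ring. }
  rewrite Heq. destruct l as [|l]; [simpl; rewrite Cmod_0; lra|].
  rewrite csum_abel.
  eapply Rle_trans; [apply Cmod_triangle|].
  set (A := fun k => exp (- (Re w * log_S (m + k)))).
  assert (HA : forall k, 0 < A k) by (intros; apply exp_pos).
  assert (HA1 : forall k, A k <= 1).
  { intros k. unfold A. rewrite <- exp_0. apply exp_mono.
    pose proof (log_S_nonneg (m + k)). nra. }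
  assert (Hkw : 1 + Rabs (Im w) / Re w <= kap).
  { unfold kap. apply Rplus_le_compat_l. rewrite Hwi. unfold Rdiv.
    apply Rmult_le_compat; [apply Rabs_pos| |exact HzY|].
    - apply Rlt_le, Rinv_0_lt_compat; lra.
    - apply Rinv_le_contravar; lra. }
  assert (H1 : Cmod (csum (fun k => csum u (S k) * (v k - v (S k)))%C l)
               <= h * kap * (A O - A l)).
  { rewrite <- rsum_telescope, <- rsum_scal. apply Cmod_csum_le. intros k _.
    rewrite Cmod_mult, Rmult_assoc. apply Rmult_le_compat; try apply Cmod_ge_0; [apply Hu|].
    unfold v, A. rewrite !Nat.add_succ_r.
    eapply Rle_trans; [apply npow_neg_variation; lra|].
    apply Rmult_le_compat_r; [|exact Hkw].
    assert (exp (- (Re w * log_S (S (m + k)))) <= exp (- (Re w * log_S (m + k)))); [|lra].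
    apply exp_mono. pose proof (log_S_le (m + k) (S (m + k)) ltac:(lia)). nra. }
  assert (H2 : Cmod (csum u (S l) * v l)%C <= h * 1).
  { rewrite Cmod_mult. apply Rmult_le_compat; try apply Cmod_ge_0; [apply Hu|].
    unfold v. rewrite Cmod_npow_neg. apply (HA1 l). }
  replace e with (h * (kap + 1)) by (unfold h; field; lra).
  pose proof (HA l). pose proof (HA1 O).
  assert (h * kap * (A O - A l) <= h * kap * 1).
  { apply Rmult_le_compat_l; [nra|lra]. }
  lra.
Qed.

Lemma exp_INR_mult k y : exp (INR k * y) = exp y ^ k.
Proof.
  induction k as [|k IH]; [simpl; rewrite Rmult_0_l; apply exp_0|].
  rewrite S_INR, Rmult_plus_distr_r, exp_plus, IH, Rmult_1_l. simpl. ring.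
Qed.

Lemma pow_le_exp k : exists c, 0 <= c /\ forall x, 0 <= x -> x ^ k <= c * exp x.
Proof.
  (* The constant comes from writing [x = (k + 1) y] and using [y <= exp y]. *)
  exists (INR (S k) ^ k). pose proof (INR_S_pos k) as Hk. split; [apply pow_le; lra|].
  intros x Hx. set (y := x / INR (S k)).
  assert (Hy : 0 <= y) by (apply Rdiv_le_0_compat; lra).
  replace x with (INR (S k) * y) at 1 by (unfold y; field; lra).
  rewrite Rpow_mult_distr. apply Rmult_le_compat_l; [apply pow_le; lra|].
  apply Rle_trans with (exp y ^ k).
  - apply pow_incr. pose proof (exp_ineq1_le y). lra.
  - rewrite <- exp_INR_mult. apply exp_mono. replace x with (INR (S k) * y) by (unfold y; field; lra).
    rewrite S_INR. lra.
Qed.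

(** At [x = log n] the right side is [T n]: the powers of [log n] in the Taylor polynomial cost a
    single power of [n]. *)
Lemma exp_taylor_le_exp K : exists T, 0 <= T /\
  forall x, 0 <= x -> Cmod (exp_taylor K (RtoC (4 * x))) <= T * exp x.
Proof.
  induction K as [|K [T [HT IH]]].
  - exists 0. split; [lra|]. intros x _. unfold exp_taylor. simpl. rewrite Cmod_0. lra.
  - destruct (pow_le_exp K) as [c [Hc Hpow]].
    set (d := / INR (fact K) * 4 ^ K).
    assert (Hd : 0 <= d).
    { apply Rmult_le_pos; [apply Rlt_le, Rinv_0_lt_compat, INR_fact_lt_0|apply pow_le; lra]. }
    exists (T + d * c). split; [nra|]. intros x Hx.
    unfold exp_taylor. cbn [csum]. eapply Rle_trans; [apply Cmod_triangle|].
    specialize (IH x Hx). unfold exp_taylor in IH.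
    rewrite <- RtoC_pow, <- RtoC_mult, (Cmod_RtoC_nonneg (_ * _)).
    + rewrite Rpow_mult_distr, <- Rmult_assoc. fold d. specialize (Hpow x Hx).
      apply (Rmult_le_compat_l d) in Hpow; [|exact Hd]. lra.
    + apply Rmult_le_pos; [apply Rlt_le, Rinv_0_lt_compat, INR_fact_lt_0|].
      apply pow_le. lra.
Qed.

Lemma convergent_bounded (u : nat -> C) l :
  (forall e, 0 < e -> exists N, forall n, (N <= n)%nat -> Cmod (u n - l)%C <= e) ->
  exists B, forall n, Cmod (u n) <= B.
Proof.
  intros H. destruct (H 1 ltac:(lra)) as [N HN].
  destruct (finite_bound (fun n => Cmod (u n)) N) as [X [HX HXb]].
  exists (X + Cmod l + 1). pose proof (Cmod_ge_0 l). intros n.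
  destruct (Nat.lt_ge_cases n N) as [Hn|Hn].
  - specialize (HXb n Hn). rewrite Rabs_pos_eq in HXb by apply Cmod_ge_0. lra.
  - specialize (HN n Hn). pose proof (Cmod_triangle_sub (u n) l). lra.
Qed.

(** The approximant truncates at [N] the series with coefficients [p], which is the Taylor
    polynomial about [s + c] evaluated at [s + eps]. Neither [K] nor [N] depends on [s]. The length
    beyond which partial sums are bounded by [M + 1] on the disc does depend on [s], but it drops
    out of the final estimate. *)
Lemma translate_uniform_dirichlet (A : nat -> Prop) (a : nat -> C) (F : C -> C) (M eps : R) :
  supported A a ->
  (forall s : C, 0 < Re s -> forall e, 0 < e ->
     exists N, forall n, (N <= n)%nat -> Cmod (dsum a s n - F s)%C <= e) ->
  (forall s : C, 0 < Re s -> Cmod (F s) <= M) ->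
  0 < eps ->
  uniform_dirichlet A (fun s => F (s + RtoC eps)%C).
Proof.
  intros HA Hconv HM Heps eta Heta.
  assert (HM0 : 0 <= M).
  { eapply Rle_trans; [apply Cmod_ge_0|]. apply (HM (RtoC 1)). simpl. lra. }
  (* The disc of radius [r] about [s + c] stays in [Re z >= eps / 2], and [s + eps] is at distance
     [4 = rho r] from its centre. The [4] supplies [n^-4], which against [O(n)] for [a n] and [O(n)]
     for the Taylor polynomial leaves a summable [n^-2]. *)
  set (c := 4 + eps). set (r := 4 + eps / 2). set (rho := 4 / r).
  assert (Hr : 4 < r) by (unfold r; lra).
  assert (Hrho : 0 < rho < 1).
  { unfold rho. split; [apply Rdiv_lt_0_compat; lra|]. apply Rlt_div_l; lra. }
  assert (HD : exists D, 0 <= D /\ forall k, Cmod (a (S k)) <= D * exp (log_S k)).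
  { destruct (convergent_bounded (dsum a (RtoC 1)) (F (RtoC 1))) as [D HD].
    { apply Hconv. simpl; lra. }
    exists (2 * D). split.
    { specialize (HD O). pose proof (Cmod_ge_0 (dsum a (RtoC 1) 0)). lra. }
    intros k.
    assert (H : Cmod (a (S k) * npow_neg (S k) (RtoC 1))%C <= 2 * D).
    { replace (a (S k) * npow_neg (S k) (RtoC 1))%C
        with (dsum a (RtoC 1) (S k) - dsum a (RtoC 1) k)%C by (unfold dsum; cbn [csum]; ring).
      eapply Rle_trans; [apply Cmod_triangle|]. rewrite Cmod_opp.
      pose proof (HD k). pose proof (HD (S k)). lra. }
    rewrite Cmod_mult, Cmod_npow_neg, exp_Ropp in H. simpl Re in H.
    rewrite Rmult_1_l in H. fold (log_S k) in H. pose proof (exp_pos (log_S k)).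
    replace (Cmod (a (S k)))
      with ((Cmod (a (S k)) * / exp (log_S k)) * exp (log_S k)) by (field; lra).
    apply Rmult_le_compat_r; lra. }
  destruct HD as [D [HD0 HD]].
  assert (HK : exists K, (M + 1) * rho ^ K / (1 - rho) <= eta / 3).
  { assert (Hy : 0 < eta / 3 * (1 - rho) / (M + 1)).
    { apply Rdiv_lt_0_compat; [apply Rmult_lt_0_compat|]; lra. }
    destruct (pow_lt_1_zero rho ltac:(rewrite Rabs_pos_eq; lra) _ Hy) as [K HK].
    exists K. specialize (HK K ltac:(lia)). rewrite Rabs_pos_eq in HK by (apply pow_le; lra).
    apply Rle_div_l; [lra|].
    replace (eta / 3 * (1 - rho)) with ((M + 1) * (eta / 3 * (1 - rho) / (M + 1))) by (field; lra).
    apply Rmult_le_compat_l; lra. }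
  destruct HK as [K HK].
  destruct (exp_taylor_le_exp K) as [T [HT HTb]].
  set (p := fun n => (a n * exp_taylor K (RtoC (4 * ln (INR n))) * npow_neg n (RtoC c))%C).
  assert (Hp : forall k, Cmod (p (S k)) <= 2 * (D * T) * (/ INR (S k) - / INR (S (S k)))).
  { intros k. unfold p. rewrite !Cmod_mult, Cmod_npow_neg. simpl Re. fold (log_S k).
    pose proof (log_S_nonneg k) as Hl. pose proof (INR_S_pos k) as Hk.
    apply Rle_trans with ((D * exp (log_S k)) * (T * exp (log_S k)) * exp (- (4 * log_S k))).
    - apply Rmult_le_compat.
      + apply Rmult_le_pos; apply Cmod_ge_0.
      + apply Rlt_le, exp_pos.
      + apply Rmult_le_compat; try apply Cmod_ge_0; [apply HD|now apply HTb].
      + apply exp_mono. unfold c. nra.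
    - replace (- (4 * log_S k)) with (- log_S k + - log_S k + (- log_S k + - log_S k)) by ring.
      rewrite !exp_plus, !exp_Ropp, exp_log_S.
      replace (D * INR (S k) * (T * INR (S k)) * (/ INR (S k) * / INR (S k) * (/ INR (S k) * / INR (S k))))
        with (D * T * (/ INR (S k) * / INR (S k))) by (field; lra).
      replace (2 * (D * T) * (/ INR (S k) - / INR (S (S k))))
        with (D * T * (2 * (/ INR (S k) - / INR (S (S k))))) by ring.
      (* [1 / x^2 <= 2 (1/x - 1/(x + 1))] for [x >= 1], so that the tails telescope. *)
      apply Rmult_le_compat_l; [nra|]. rewrite (S_INR (S k)).
      assert (1 <= INR (S k)) by (apply (le_INR 1); lia).
      set (x := INR (S k)) in *.
      apply (Rmult_le_reg_r (x * x * (x + 1))); [nra|].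
      replace (/ x * / x * (x * x * (x + 1))) with (x + 1) by (field; lra).
      replace (2 * (/ x - / (x + 1)) * (x * x * (x + 1))) with (2 * x) by (field; lra).
      lra. }
  set (W := 2 * (D * T)).
  assert (HW : 0 <= W) by (unfold W; nra).
  destruct (inv_INR_small (eta / 3 / (W + 1))) as [N HN].
  { apply Rdiv_lt_0_compat; lra. }
  assert (Htail : forall n s, (N <= n)%nat -> 0 < Re s ->
            Cmod (dsum p s n - dsum p s N)%C <= eta / 3).
  { intros n s Hn Hs. unfold dsum. replace n with (N + (n - N))%nat by lia.
    rewrite csum_split.
    match goal with |- Cmod (?x + ?y - ?x)%C <= _ => replace (x + y - x)%C with y by ring end.
    apply Rle_trans with (W * / INR (S N)).
    - apply Rle_trans with
        (rsum (fun k => W * (/ INR (S (N + k)) - / INR (S (N + S k)))) (n - N)).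
      + apply Cmod_csum_le. intros k _. rewrite Cmod_mult, <- Rmult_1_r, Nat.add_succ_r.
        apply Rmult_le_compat; try apply Cmod_ge_0; [apply Hp|].
        apply Cmod_npow_neg_le_1. lra.
      + rewrite rsum_scal, (rsum_telescope (fun k => / INR (S (N + k)))).
        apply Rmult_le_compat_l; [exact HW|]. rewrite Nat.add_0_r.
        pose proof (Rinv_0_lt_compat _ (INR_S_pos (N + (n - N)))). lra.
    - specialize (HN N (le_n N)).
      apply Rle_trans with ((W + 1) * (eta / 3 / (W + 1))).
      + pose proof (Rinv_0_lt_compat _ (INR_S_pos N)). apply Rmult_le_compat; lra.
      + right. field. lra. }
  exists (fun s => dsum p s N). split.
  - exists (fun n => if Nat.leb n N then p n else RtoC 0), N. split; [split|].
    + intros n Hn HnA. destruct (Nat.leb n N); [|reflexivity].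
      unfold p. rewrite HA by assumption. ring.
    + intros n Hn. destruct (Nat.leb_spec n N); [lia|reflexivity].
    + intros s. apply csum_ext. intros k Hk. destruct (Nat.leb_spec (S k) N); [reflexivity|lia].
  - intros s Hs. simpl.
    apply (le_of_forall_eps _ _ 1); [lra|]. intros e He.
    destruct (Hconv (s + RtoC eps)%C ltac:(simpl; unfold Re in Hs; lra) e He) as [N1 HN1].
    (* Uniform convergence on a half-strip containing the disc transfers the bound [M] of [F] to
       long partial sums; the extra [1] is two errors of [1/2]. *)
    assert (HN2 : exists N2, forall n, (N2 <= n)%nat -> forall z : C,
              eps / 2 <= Re z -> Rabs (Im z) <= Rabs (Im s) + r -> Cmod (dsum a z n) <= M + 1).
    { destruct (dsum_uniform_cauchy a (eps / 4) (eps / 4) (Rabs (Im s) + r)) with (e := / 2)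
        as [N2 HN2]; [|lra|pose proof (Rabs_pos (Im s)); lra|lra|].
      - intros e' He'. destruct (Hconv (RtoC (eps / 4)) ltac:(simpl; lra) (e' / 2) ltac:(lra))
          as [N3 HN3].
        exists N3. intros m n Hm Hn.
        pose proof (Cmod_triangle3 (dsum a (RtoC (eps / 4)) m) (F (RtoC (eps / 4)))
                      (dsum a (RtoC (eps / 4)) n)).
        pose proof (HN3 m Hm). pose proof (HN3 n Hn) as H3. rewrite Cmod_sub_sym in H3. lra.
      - exists N2. intros n Hn z Hz Hzi.
        destruct (Hconv z ltac:(lra) (/ 2) ltac:(lra)) as [N3 HN3].
        specialize (HN2 n (max n N3) Hn ltac:(lia) z ltac:(lra) Hzi).
        specialize (HN3 (max n N3) ltac:(lia)).
        pose proof (HM z ltac:(lra)).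
        pose proof (Cmod_triangle_sub (dsum a z (max n N3)) (F z)).
        rewrite Cmod_sub_sym in HN2.
        pose proof (Cmod_triangle_sub (dsum a z n) (dsum a z (max n N3))). lra. }
    destruct HN2 as [N2 HN2].
    set (n := max N (max N1 N2)).
    specialize (HN1 n ltac:(unfold n; lia)). specialize (HN2 n ltac:(unfold n; lia)).
    specialize (Htail n s ltac:(unfold n; lia) Hs).
    set (z0 := (s + RtoC c)%C).
    assert (Htay := dsum_taylor (fun n => a n * npow_neg n z0)%C n r (M + 1) rho (RtoC (-4)) K
                      ltac:(lra) ltac:(lra)).
    assert (Hb : forall w, Cmod w = r ->
              Cmod (dsum (fun n => a n * npow_neg n z0)%C w n) <= M + 1).
    { intros w Hw. rewrite dsum_translate.
      destruct (Rabs_Re_Im_le w) as [H1 H2]. rewrite Hw in H1, H2.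
      apply Rabs_le_between in H1. apply HN2.
      - unfold z0, c, r in *. simpl. unfold Re in *. lra.
      - unfold z0. replace (Im (w + (s + RtoC c))%C) with (Im s + Im w)
          by (simpl; unfold Im; ring).
        eapply Rle_trans; [apply Rabs_triang|]. lra. }
    specialize (Htay Hb). rewrite Cmod_R in Htay.
    replace (Rabs (-4)) with 4 in Htay by (rewrite Rabs_left; lra).
    specialize (Htay ltac:(unfold rho; right; field; lra)).
    rewrite dsum_translate in Htay.
    replace (RtoC (-4) + z0)%C with (s + RtoC eps)%C in Htay.
    2:{ unfold z0, c. rewrite RtoC_plus.
      replace (RtoC (-4)) with (- RtoC 4)%C by (rewrite <- RtoC_opp; f_equal; ring). ring. }
    replace (csum (fun n => a (S n) * npow_neg (S n) z0 *
               exp_taylor K (- RtoC (-4) * RtoC (log_S n)))%C n) with (dsum p s n) in Htay.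
    2:{ apply csum_ext. intros k _. unfold p, z0. rewrite npow_neg_add. fold (log_S k).
        replace (- RtoC (-4) * RtoC (log_S k))%C with (RtoC (4 * log_S k)); [ring|].
        rewrite <- RtoC_opp, <- RtoC_mult. f_equal. ring. }
    rewrite Cmod_sub_sym in HN1.
    pose proof (Cmod_triangle3 (F (s + RtoC eps)%C) (dsum a (s + RtoC eps)%C n) (dsum p s N)).
    pose proof (Cmod_triangle3 (dsum a (s + RtoC eps)%C n) (dsum p s n) (dsum p s N)).
    lra.
Qed.

(** * Inversion *)

Lemma Cmod_ge_neq_0 z d : 0 < d -> d <= Cmod z -> z <> RtoC 0.
Proof. intros Hd H ->. rewrite Cmod_0 in H. lra. Qed.

(** With [u = 1 - G H], the Neumann series of [1 / H] is [G] times the sum of the powers of [u]. Cut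
    after [K] terms, its error is [G u^K / (G H)], at most [2 B 2^-K] since [|G H| >= 1/2]. *)
Lemma uniform_dirichlet_inv_near A G H :
  mult_subsemigroup A -> A 1%nat ->
  uniform_dirichlet A G -> uniform_dirichlet A H ->
  (forall s : C, 0 < Re s -> Cmod (1 - G s * H s)%C <= / 2) ->
  uniform_dirichlet A (fun s => / H s)%C.
Proof.
  intros HA H1 HG HH Hu. apply uniform_dirichlet_limit. intros e He.
  destruct (uniform_dirichlet_bounded A G HG) as [B [HB HGB]].
  set (u := fun s => (1 - G s * H s)%C).
  assert (Huu : uniform_dirichlet A u).
  { apply (uniform_dirichlet_ext _ (fun s => 1 + (- (1)) * (G s * H s))%C).
    - intros. unfold u. ring.
    - apply uniform_dirichlet_add; [apply uniform_dirichlet_poly, dirichlet_poly_const, H1|].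
      apply uniform_dirichlet_mult; auto.
      + apply uniform_dirichlet_poly, dirichlet_poly_const, H1.
      + now apply uniform_dirichlet_mult. }
  destruct (pow_lt_1_zero (/ 2) ltac:(rewrite Rabs_pos_eq; lra) (e / (2 * B + 1)))
    as [K HK]; [apply Rdiv_lt_0_compat; lra|].
  specialize (HK K ltac:(lia)). rewrite Rabs_pos_eq in HK by (apply pow_le; lra).
  exists (fun s => G s * csum (fun k => Cpow (u s) k) K)%C. split.
  - apply uniform_dirichlet_mult; auto. apply uniform_dirichlet_csum.
    intros k _. now apply uniform_dirichlet_pow.
  - intros s Hs. specialize (Hu s Hs). specialize (HGB s Hs). fold (u s) in Hu.
    pose proof (geometric_csum (u s) K) as Hgeo.
    change (csum (fun k => Cpow (u s) k) K) with (csum (Cpow (u s)) K).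
    set (S0 := csum (Cpow (u s)) K) in *.
    assert (HGH : / 2 <= Cmod (G s * H s)%C).
    { pose proof (Cmod_triangle_sub 1 (G s * H s)%C) as Ht. rewrite Cmod_1 in Ht.
      unfold u in Hu. lra. }
    assert (HGH0 := Cmod_ge_neq_0 (G s * H s)%C (/ 2) ltac:(lra) HGH).
    assert (HH0 : H s <> RtoC 0) by (intros H0; apply HGH0; rewrite H0; ring).
    assert (HG0 : G s <> RtoC 0) by (intros H0; apply HGH0; rewrite H0; ring).
    replace (/ H s - G s * S0)%C with (G s * (/ (G s * H s) * Cpow (u s) K))%C.
    2:{ replace (Cpow (u s) K) with ((u s - 1) * S0 + 1)%C by (rewrite Hgeo; ring).
        unfold u. field. split; assumption. }
    rewrite !Cmod_mult, Cmod_inv, Cmod_pow by assumption.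
    assert (Hinv : / Cmod (G s * H s)%C <= 2).
    { rewrite <- (Rinv_inv 2). apply Rinv_le_contravar; lra. }
    assert (Hpow : Cmod (u s) ^ K <= (/ 2) ^ K).
    { apply pow_incr. split; [apply Cmod_ge_0|exact Hu]. }
    apply Rle_trans with (B * (2 * (/ 2) ^ K)).
    + apply Rmult_le_compat; [apply Cmod_ge_0| |exact HGB|].
      * apply Rmult_le_pos; [apply Rlt_le, Rinv_0_lt_compat; lra|apply pow_le, Cmod_ge_0].
      * apply Rmult_le_compat; [apply Rlt_le, Rinv_0_lt_compat; lra|apply pow_le, Cmod_ge_0| |];
          assumption.
    + pose proof (pow_lt (/ 2) K ltac:(lra)).
      apply Rle_trans with ((2 * B + 1) * (/ 2) ^ K); [nra|].
      replace e with ((2 * B + 1) * (e / (2 * B + 1))) by (field; lra).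
      apply Rmult_le_compat_l; lra.
Qed.

Lemma uniform_dirichlet_translate A F t :
  0 <= t -> uniform_dirichlet A F -> uniform_dirichlet A (fun s => F (s + RtoC t)%C).
Proof.
  intros Ht HF e He. destruct (HF e He) as [P [[a [N [Ha HP]]] HFP]].
  exists (fun s => P (s + RtoC t)%C). split.
  - exists (fun n => a n * npow_neg n (RtoC t))%C, N. split; [split|].
    + intros n Hn HA. rewrite (proj1 Ha) by assumption. ring.
    + intros n Hn. rewrite (proj2 Ha) by assumption. ring.
    + intros s. rewrite HP, dsum_translate. reflexivity.
  - intros s Hs. apply HFP. simpl. unfold Re in Hs. lra.
Qed.

(** A Dirichlet polynomial has derivative bounded by the constant [B] on the half-plane. The
    uniformity in [s] fails for general bounded Dirichlet series; here it gives the inversion one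
    step length valid everywhere. *)
Lemma uniform_dirichlet_modulus_continuity A F eta :
  uniform_dirichlet A F -> 0 < eta ->
  exists tau, 0 < tau /\ forall (s : C) t, 0 < Re s -> 0 <= t <= tau ->
    Cmod (F s - F (s + RtoC t))%C <= eta.
Proof.
  intros HF Heta. destruct (HF (eta / 3) ltac:(lra)) as [P [[a [N [Ha HP]]] HFP]].
  set (B := rsum (fun k => Cmod (a (S k)) * log_S k) N).
  assert (HB : 0 <= B).
  { apply rsum_nonneg. intros k _. pose proof (log_S_nonneg k).
    apply Rmult_le_pos; [apply Cmod_ge_0|assumption]. }
  exists (eta / 3 / (B + 1)). split; [apply Rdiv_lt_0_compat; lra|].
  intros s t Hs Ht.
  assert (Hst : 0 < Re (s + RtoC t)%C) by (simpl; unfold Re in Hs; lra).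
  assert (HPP : Cmod (P s - P (s + RtoC t))%C <= B * t).
  { rewrite !HP. unfold dsum, B. rewrite <- csum_sub, <- rsum_scal_r.
    apply Cmod_csum_le. intros k _. pose proof (log_S_nonneg k).
    rewrite npow_neg_add, npow_neg_real. fold (log_S k).
    set (E := exp (- (t * log_S k))).
    assert (HE : 1 - t * log_S k <= E <= 1).
    { unfold E. split; [pose proof (exp_ineq1_le (- (t * log_S k))); lra|].
      rewrite <- exp_0. apply exp_mono. nra. }
    replace (a (S k) * npow_neg (S k) s - a (S k) * (npow_neg (S k) s * RtoC E))%C
      with (a (S k) * (npow_neg (S k) s * RtoC (1 - E)))%C by (rewrite RtoC_minus; ring).
    rewrite !Cmod_mult, (Cmod_RtoC_nonneg (1 - E)), Rmult_assoc by lra.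
    apply Rmult_le_compat_l; [apply Cmod_ge_0|].
    pose proof (Cmod_npow_neg_le_1 k s ltac:(lra)). pose proof (Cmod_ge_0 (npow_neg (S k) s)).
    nra. }
  assert (HBt : B * t <= eta / 3).
  { apply Rle_trans with ((B + 1) * (eta / 3 / (B + 1))).
    - apply Rmult_le_compat; lra.
    - right. field. lra. }
  pose proof (HFP s Hs) as H1. pose proof (HFP _ Hst) as H2. rewrite Cmod_sub_sym in H2.
  pose proof (Cmod_triangle3 (F s) (P s) (F (s + RtoC t)%C)).
  pose proof (Cmod_triangle3 (P s) (P (s + RtoC t)%C) (F (s + RtoC t)%C)). lra.
Qed.

(** [c] is the constant coefficient of an approximating polynomial, so a nonzero [c] forces [1] into
    [A]. *)
Lemma uniform_dirichlet_at_infinity (A : nat -> Prop) F eta :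
  uniform_dirichlet A F -> 0 < eta ->
  exists c T, 0 <= T /\ (~ A 1%nat -> c = RtoC 0) /\
    forall s : C, 0 < Re s -> Cmod (F (s + RtoC T) - c)%C <= eta.
Proof.
  intros HF Heta. destruct (HF (eta / 2) ltac:(lra)) as [P [[a [N [Ha HP]]] HFP]].
  set (B := rsum (fun k => Cmod (a (S (S k)))) N).
  assert (HB : 0 <= B) by (apply rsum_nonneg; intros; apply Cmod_ge_0).
  (* For [n >= 2] one has [log n >= 1/2], so [n^-(2y) <= exp (- y) <= 1 / y], and
     [B / y <= eta / 2]. *)
  set (y := 2 * (B + 1) / eta).
  assert (Hy : 0 < y) by (apply Rdiv_lt_0_compat; lra).
  exists (a 1%nat), (2 * y). split; [lra|]. split.
  { intros H. apply (proj1 Ha); [lia|exact H]. }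
  intros s Hs.
  assert (Hst : 0 < Re (s + RtoC (2 * y))%C) by (simpl; unfold Re in Hs; lra).
  assert (HPa : Cmod (P (s + RtoC (2 * y))%C - a 1%nat)%C <= eta / 2).
  { rewrite HP, <- (dsum_stable A a N (S N)) by (assumption || lia).
    unfold dsum. rewrite csum_shift, npow_neg_1, Cmult_1_r.
    match goal with |- Cmod (?x + ?z - ?x)%C <= _ =>
      replace (x + z - x)%C with z by ring end.
    apply Rle_trans with (rsum (fun k => Cmod (a (S (S k))) * / y) N).
    - apply Cmod_csum_le. intros k _. rewrite Cmod_mult.
      apply Rmult_le_compat_l; [apply Cmod_ge_0|].
      rewrite Cmod_npow_neg, exp_Ropp. apply Rinv_le_contravar; [exact Hy|].
      apply Rle_trans with (exp y); [pose proof (exp_ineq1_le y); lra|].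
      apply exp_mono.
      assert (/ 2 <= log_S (S k)).
      { pose proof ln_lt_2. pose proof (log_S_le 1 (S k) ltac:(lia)).
        unfold log_S in H0 at 1. replace (INR 2) with 2 in H0 by reflexivity. lra. }
      change (ln (INR (S (S k)))) with (log_S (S k)).
      assert (Hre : 2 * y <= Re (s + RtoC (2 * y))%C) by (simpl; unfold Re in Hs; lra).
      nra.
    - rewrite rsum_scal_r. fold B. apply Rle_div_l; [exact Hy|].
      replace (eta / 2 * y) with (B + 1) by (unfold y; field; lra). lra. }
  pose proof (HFP _ Hst).
  pose proof (Cmod_triangle3 (F (s + RtoC (2 * y))%C) (P (s + RtoC (2 * y))%C) (a 1%nat)).
  lra.
Qed.

(* Continuation along the translates [F(. + t)], [t] decreasing from a large [T] to [0]: the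
   inverses stay bounded by [1/delta], so each Neumann step may have the same length. *)
Lemma uniform_dirichlet_inv A F delta :
  mult_subsemigroup A -> uniform_dirichlet A F -> 0 < delta ->
  (forall s : C, 0 < Re s -> delta <= Cmod (F s)) ->
  uniform_dirichlet A (fun s => / F s)%C.
Proof.
  intros HA HF Hdelta Hlow.
  assert (Hne : forall s : C, 0 < Re s -> F s <> RtoC 0).
  { intros s Hs. apply (Cmod_ge_neq_0 _ delta); auto. }
  (* [delta / 4] gives [|c| >= 3 delta / 4], hence [|1 - F / c| <= 1/3] far to the right; the
     modulus of continuity for [delta / 2] keeps the later quantities [|1 - F(z) / F(z + T/J)|] at
     most [1/2]. *)
  destruct (uniform_dirichlet_at_infinity A F (delta / 4) HF ltac:(lra))
    as [c [T [HT [Hc Hinf]]]].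
  assert (Hcl : 3 / 4 * delta <= Cmod c).
  { specialize (Hinf (RtoC 1) ltac:(simpl; lra)).
    pose proof (Hlow (RtoC 1 + RtoC T)%C ltac:(simpl; lra)).
    pose proof (Cmod_triangle_sub (F (RtoC 1 + RtoC T)%C) c). lra. }
  assert (Hc0 := Cmod_ge_neq_0 c (3 / 4 * delta) ltac:(lra) Hcl).
  (* The lower bound on [|F|] is what brings the constants into the algebra. *)
  assert (HA1 : A 1%nat) by (apply NNPP; intros H; exact (Hc0 (Hc H))).
  destruct (uniform_dirichlet_modulus_continuity A F (delta / 2) HF ltac:(lra))
    as [tau [Htau Hcont]].
  destruct (le_INR_exists (T / tau + 1)) as [J HJ].
  assert (HTt : 0 <= T / tau) by (apply Rdiv_le_0_compat; lra).
  assert (HJ0 : 0 < INR J) by lra.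
  assert (Hstep : 0 <= T / INR J <= tau).
  { split; [apply Rdiv_le_0_compat; lra|]. apply Rle_div_l; [lra|].
    replace T with (tau * (T / tau)) by (field; lra). apply Rmult_le_compat_l; lra. }
  set (t := fun j => T - INR j * (T / INR J)).
  assert (Ht : forall j, (j <= J)%nat -> 0 <= t j).
  { intros j Hj. apply le_INR in Hj. unfold t.
    assert (INR j * (T / INR J) <= INR J * (T / INR J)) by (apply Rmult_le_compat_r; lra).
    replace (INR J * (T / INR J)) with T in H by (field; lra). lra. }
  assert (Hall : forall j, (j <= J)%nat -> uniform_dirichlet A (fun s => / F (s + RtoC (t j)))%C).
  { induction j as [|j IH]; intros Hj.
    - apply (uniform_dirichlet_inv_near A (fun _ => / c)%C); auto.
      + apply uniform_dirichlet_poly, dirichlet_poly_const, HA1.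
      + apply uniform_dirichlet_translate; [now apply Ht|exact HF].
      + intros s Hs. unfold t. simpl INR. rewrite Rmult_0_l, Rminus_0_r.
        specialize (Hinf s Hs). rewrite Cmod_sub_sym in Hinf.
        replace (1 - / c * F (s + RtoC T))%C with ((c - F (s + RtoC T)) * / c)%C
          by (field; exact Hc0).
        rewrite Cmod_mult, Cmod_inv by exact Hc0.
        apply Rle_div_l; lra.
    - specialize (IH ltac:(lia)).
      apply (uniform_dirichlet_inv_near A (fun s => / F (s + RtoC (t j)))%C); auto.
      + apply uniform_dirichlet_translate; [now apply Ht|exact HF].
      + intros s Hs. pose proof (Ht (S j) Hj) as Htj.
        set (z := (s + RtoC (t (S j)))%C).
        assert (Hz : 0 < Re z) by (unfold z; simpl; unfold Re in Hs; lra).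
        replace (s + RtoC (t j))%C with (z + RtoC (T / INR J))%C.
        2:{ unfold z. rewrite <- Cplus_assoc, <- RtoC_plus. do 2 f_equal.
            unfold t. rewrite S_INR. ring. }
        assert (Hz' : 0 < Re (z + RtoC (T / INR J))%C) by (change (0 < Re z + T / INR J); lra).
        specialize (Hcont z (T / INR J) Hz Hstep). rewrite Cmod_sub_sym in Hcont.
        pose proof (Hne _ Hz') as Hn. pose proof (Hlow _ Hz') as Hl.
        replace (1 - / F (z + RtoC (T / INR J)) * F z)%C
          with ((F (z + RtoC (T / INR J)) - F z) * / F (z + RtoC (T / INR J)))%C
          by (field; exact Hn).
        rewrite Cmod_mult, Cmod_inv by exact Hn.
        apply Rle_div_l; lra. }
  apply (uniform_dirichlet_ext _ (fun s => / F (s + RtoC (t J)))%C); [|now apply Hall].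
  intros s _. replace (t J) with 0 by (unfold t; field; lra). now rewrite Cplus_0_r.
Qed.

(** * Dirichlet series on the half-plane *)

Lemma sum_n_csum (u : nat -> C) n :
  @sum_n C_AbelianMonoid u n = csum u (S n).
Proof.
  induction n as [|n IH].
  - rewrite sum_O. symmetry. apply Cplus_0_l.
  - rewrite sum_Sn, IH. reflexivity.
Qed.

Lemma is_series_dsum (a : nat -> C) (s : C) (l : C) :
  @is_series C_AbsRing C_NormedModule (fun k => a (S k) * npow_neg (S k) s)%C l <->
  forall e, 0 < e -> exists N, forall n, (N <= n)%nat -> Cmod (dsum a s n - l)%C <= e.
Proof.
  unfold is_series.
  pose proof (filterlim_locally_ball_norm (K := C_AbsRing) (U := C_NormedModule)
    (F := Hierarchy.eventually) (@sum_n C_AbelianMonoid (fun k => a (S k) * npow_neg (S k) s)%C) l) as Hlim.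
  split.
  - intros H e He. destruct (proj1 Hlim H (mkposreal e He)) as [N HN].
    exists (S N). intros n Hn. destruct n as [|n]; [lia|].
    specialize (HN n ltac:(lia)). unfold ball_norm in HN.
    change (Cmod (@sum_n C_AbelianMonoid (fun k => a (S k) * npow_neg (S k) s)%C n - l)%C < e)
      in HN.
    rewrite sum_n_csum in HN. apply Rlt_le. exact HN.
  - intros H. refine (proj2 Hlim _). intros e. destruct (H (e / 2)) as [N HN]; [destruct e; simpl; lra|].
    exists N. intros n Hn. specialize (HN (S n) ltac:(lia)). unfold ball_norm.
    change (Cmod (@sum_n C_AbelianMonoid (fun k => a (S k) * npow_neg (S k) s)%C n - l)%C < e).
    rewrite sum_n_csum. fold (dsum a s (S n)). destruct e as [e He]; simpl in *. lra.
Qed.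

Lemma sup_norm_finite (f : C0 -> C) :
  Rbar_lt (sup_norm f) p_infty <-> exists M, forall s, Cmod (f s) <= M.
Proof.
  unfold sup_norm. destruct (Lub_Rbar_correct (modulus_values f)) as [Hub Hlub]. split.
  - intros H. destruct (Lub_Rbar (modulus_values f)) as [M| |].
    + exists M. intros s. apply (Hub (Cmod (f s))). now exists s.
    + destruct H.
    + exists 0. intros s. destruct (Hub (Cmod (f s))). now exists s.
  - intros [M HM]. apply Rbar_le_lt_trans with (Finite M); [|exact I].
    apply Hlub. intros x [s ->]. apply HM.
Qed.

Lemma inf_modulus_pos (f : C0 -> C) :
  Rbar_lt (Finite 0) (inf_modulus f) <->
  exists d, 0 < d /\ forall s, d <= Cmod (f s).
Proof.
  unfold inf_modulus. destruct (Glb_Rbar_correct (modulus_values f)) as [Hlb Hglb]. split.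
  - intros H. destruct (Glb_Rbar (modulus_values f)) as [d| |].
    + exists d. split; [exact H|]. intros s. apply (Hlb (Cmod (f s))). now exists s.
    (* An infinite infimum is contradicted by the value at any point; [1] is arbitrary. *)
    + exists 1. split; [lra|]. intros s. destruct (Hlb (Cmod (f s))). now exists s.
    + destruct H.
  - intros [d [Hd H]]. apply Rbar_lt_le_trans with (Finite d); [exact Hd|].
    apply Hglb. intros x [s ->]. apply H.
Qed.

(** A total function, with default [0] off the half-plane, so that translating an argument carries
    no proof that it stays inside. *)
Definition extend (f : C0 -> C) (z : C) : C :=
  match Rlt_dec 0 (Re z) with
  | left h => f (exist _ z h)
  | right _ => RtoC 0
  end.

Lemma extend_C0 (f : C0 -> C) (z : C) (h : 0 < Re z) : extend f z = f (exist _ z h).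
Proof.
  unfold extend. destruct (Rlt_dec 0 (Re z)) as [h'|n]; [|contradiction].
  do 2 f_equal. apply proof_irrelevance.
Qed.

Lemma has_coefs_ext A F G b : (forall s, F s = G s) -> has_coefs A F b -> has_coefs A G b.
Proof.
  intros H HF e n He. destruct (HF e n He) as [a [N [Ha [Hc Hk]]]].
  exists a, N. split; [exact Ha|]. split; [|exact Hk].
  intros s Hs. rewrite <- H. now apply Hc.
Qed.

(** The coefficients of [1 / F(. + eps)], multiplied by [n^eps], give a series controlled only where
    [Re s > eps]. By [has_coefs_unique] these products do not depend on [eps]: [eps = 1] defines
    [b], and at a given [s] a smaller [eps] proves convergence. *)
Lemma dirichlet_series_inverse (A : nat -> Prop) (a : nat -> C) (F : C -> C) M delta :
  mult_subsemigroup A -> supported A a ->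
  (forall s : C, 0 < Re s -> forall e, 0 < e ->
     exists N, forall n, (N <= n)%nat -> Cmod (dsum a s n - F s)%C <= e) ->
  0 < delta ->
  (forall s : C, 0 < Re s -> delta <= Cmod (F s) <= M) ->
  exists b, supported A b /\
    forall s : C, 0 < Re s -> forall e, 0 < e ->
      exists N, forall n, (N <= n)%nat -> Cmod (dsum b s n - / F s)%C <= e.
Proof.
  intros HA Ha Hconv Hdelta HF.
  assert (Hco : forall eps, 0 < eps ->
            exists b, has_coefs A (fun s => / F (s + RtoC eps))%C b).
  { intros eps Heps. apply uniform_dirichlet_coefs.
    apply (uniform_dirichlet_inv A (fun s => F (s + RtoC eps)%C) delta HA); [|exact Hdelta|].
    - apply (translate_uniform_dirichlet A a F M eps); auto. intros s Hs. now apply HF.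
    - intros s Hs. apply HF. simpl. unfold Re in Hs. lra. }
  destruct (Hco 1 ltac:(lra)) as [b1 Hb1].
  exists (fun n => b1 n * npow_neg n (RtoC (-1)))%C. split.
  { intros n Hn HnA. rewrite (has_coefs_supported A _ b1 Hb1) by assumption. ring. }
  intros s Hs.
  (* [eps <= 1/2] makes [1 / F(. + 1)] a forward translate of [1 / F(. + eps)], and
     [eps <= Re s / 2] keeps [s - eps] in the half-plane. *)
  set (eps := Rmin (/ 2) (Re s / 2)).
  assert (Heps : 0 < eps <= / 2 /\ eps <= Re s / 2).
  { unfold eps. pose proof (Rmin_l (/ 2) (Re s / 2)). pose proof (Rmin_r (/ 2) (Re s / 2)).
    repeat split; try assumption. apply Rmin_glb_lt; lra. }
  destruct (Hco eps ltac:(lra)) as [b Hb].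
  assert (Heq : forall k, (b1 (S k) * npow_neg (S k) (RtoC (-1)))%C =
                          (b (S k) * npow_neg (S k) (RtoC (- eps)))%C).
  { intros k.
    rewrite (has_coefs_unique A _ b1 (fun n => b n * npow_neg n (RtoC (1 - eps)))%C k Hb1).
    - rewrite <- Cmult_assoc, <- npow_neg_add, <- RtoC_plus. do 3 f_equal. ring.
    - apply (has_coefs_ext A (fun s => / F (s + RtoC (1 - eps) + RtoC eps))%C).
      + intros z. rewrite <- Cplus_assoc, <- RtoC_plus. do 4 f_equal. ring.
      + apply (has_coefs_translate A (fun s => / F (s + RtoC eps))%C); [lra|exact Hb]. }
  intros e He.
  assert (Hs' : 0 < Re (s + RtoC (- eps))%C) by (simpl; unfold Re in *; lra).
  destruct (has_coefs_converges A _ b _ Hb Hs' e He) as [N HN].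
  exists N. intros n Hn. specialize (HN n Hn).
  replace (s + RtoC (- eps) + RtoC eps)%C with s in HN
    by (rewrite RtoC_opp; ring).
  rewrite <- dsum_translate in HN.
  replace (dsum _ s n) with (dsum (fun n => b n * npow_neg n (RtoC (- eps)))%C s n); [exact HN|].
  apply csum_ext. intros k _. now rewrite Heq.
Qed.

Theorem theorem4p1 :
  forall A : nat -> Prop,
    mult_subsemigroup A ->
    forall f : C0 -> C,
      HinfS_invertible A f <->
      (HinfS A f /\ Rbar_lt (Finite 0) (inf_modulus f)).
Proof.
  intros A HA f. split.
  - intros [Hf [g [[[_ Hg] _] Hfg]]]. split; [exact Hf|].
    apply sup_norm_finite in Hg. destruct Hg as [M HM].
    (* [|f| = 1 / |g|] is bounded below as [g] is bounded; [|M| + 1] is a bound for [|g|] that is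
       visibly positive. *)
    apply inf_modulus_pos. exists (/ (Rabs M + 1)).
    pose proof (Rabs_pos M). split; [apply Rinv_0_lt_compat; lra|].
    intros s. specialize (Hfg s). apply (f_equal Cmod) in Hfg.
    rewrite Cmod_mult, Cmod_1 in Hfg. specialize (HM s). pose proof (Rle_abs M).
    pose proof (Cmod_ge_0 (f s)).
    apply (Rmult_le_reg_r (Rabs M + 1)); [lra|]. rewrite Rinv_l by lra. nra.
  - intros [Hf Hinf]. split; [exact Hf|].
    destruct Hf as [[_ Hsup] [a [Ha Hsupp]]].
    apply sup_norm_finite in Hsup. destruct Hsup as [M HM].
    apply inf_modulus_pos in Hinf. destruct Hinf as [d [Hd Hlow]].
    destruct (dirichlet_series_inverse A a (extend f) M d HA Hsupp) as [b [Hb Hconv]];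
      [|exact Hd| |].
    + intros s Hs. rewrite (extend_C0 f s Hs). apply is_series_dsum.
      apply (Ha (exist _ s Hs)).
    + intros s Hs. rewrite (extend_C0 f s Hs). split; [apply Hlow|apply HM].
    + assert (Hne : forall s, f s <> RtoC 0)
        by (intros s; exact (Cmod_ge_neq_0 _ d Hd (Hlow s))).
      assert (Hser : is_dirichlet_series b (fun s => / f s)%C).
      { intros [s Hs]. apply is_series_dsum. rewrite <- (extend_C0 f s Hs).
        now apply Hconv. }
      exists (fun s => / f s)%C. split; [split; [split|]|].
      * now exists b.
      * apply sup_norm_finite. exists (/ d). intros s. rewrite Cmod_inv by apply Hne.
        apply Rinv_le_contravar; [exact Hd|apply Hlow].
      * now exists b.
      * intros s. field. apply Hne.
Qed.
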